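(* Let $T>0$. Suppose that at least one of the following holds for problem (P) (defined in the context): (i) problem (P) has a solution in $Q_T$ that is positive in $Q_T\cup\Gamma_T$; (ii) problem (P) has a solution in $Q_T$, the initial datum $u_0$ is nonnegative in $\Omega$, and $\min(p,q,l)\ge 1$; (iii) problem (P) has a solution in $Q_T$, the initial datum $u_0$ is positive in $\overline\Omega$, and $m\ge 1$ or $p<m<1$. Then the solution of problem (P) is unique in $Q_T$.
   Context: Let $n\ge 1$, let $\Omega\subset\mathbb{R}^n$ be a bounded domain with smooth boundary $\partial\Omega$, and let $\nu$ be the unit outward normal on $\partial\Omega$. Let $p\ge 0$, $q>0$, $m>0$, $l>0$, $a>0$, $b>0$ be constants (for $p=0$, $u^p$ is understood as $1$). Let $k\in C(\partial\Omega\times\overline\Omega\times[0,+\infty))$ with $k(x,y,t)\ge 0$, and let $u_0\in C^1(\overline\Omega)$ satisfy $u_0(x)\ge 0$ in $\Omega$ and $\frac{\partial u_0(x)}{\partial\nu}=\int_\Omega k(x,y,0)u_0^l(y)\,dy$ on $\partial\Omega$. For $T>0$ put $Q_T=\Omega\times(0,T)$, $S_T=\partial\Omega\times(0,T)$, $\Gamma_T=S_T\cup(\overline\Omega\times\{0\})$. Problem (P): $$u_t=\Delta u+a u^p\int_0^t u^q(x,\tau)\,d\tau-bu^m,\quad x\in\Omega,\ t>0,$$ $$\frac{\partial u(x,t)}{\partial\nu}=\int_\Omega k(x,y,t)u^l(y,t)\,dy,\quad x\in\partial\Omega,\ t>0,$$ $$u(x,0)=u_0(x),\quad x\in\Omega.$$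 A solution of (P) in $Q_T$ is a nonnegative function $u\in C^{2,1}(Q_T)\cap C^{1,0}(Q_T\cup\Gamma_T)$ satisfying the equation for $(x,t)\in Q_T$, the boundary condition for $(x,t)\in S_T$, and the initial condition for $x\in\Omega$. *)

(* Defs.v *)
From HB Require Import structures.
From mathcomp Require Import all_boot all_order all_algebra.
From mathcomp Require Import all_classical all_reals all_analysis.
From mathcomp Require Import lra.

Set Implicit Arguments.
Unset Strict Implicit.
Unset Printing Implicit Defensive.

Import Order.TTheory GRing.Theory Num.Theory.
Import numFieldNormedType.Exports.

Local Open Scope classical_set_scope.
Local Open Scope ring_scope.

Definition rVBorel (R : realType) (n : nat) :=
  g_sigma_algebraType (@open 'rV[R]_n).

Section lebesgue_rV.
Context {R : realType}.

Let ratbox n (qk : 'rV[rat]_n * nat) : set 'rV[R]_n :=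
  [set v | forall i, v 0 i \in
    `](ratr (qk.1 0 i) - qk.2.+1%:R^-1), (ratr (qk.1 0 i) + qk.2.+1%:R^-1)[].

Let open_ratboxE n (U : set 'rV[R]_n) : open U ->
  U = \bigcup_(qk in [set qk | ratbox qk `<=` U]) ratbox qk.
Proof.
move=> oU; apply/seteqP; split => [x Ux|x [qk /= + qkx]]; last exact.
have /nbhs_ballP [e /= e0 xeU] : nbhs x U by exact: open_nbhs_nbhs.
have [k ke] : exists k : nat, k.+1%:R^-1 < e / 2.
  exists (Num.truncn (e / 2)^-1).
  by rewrite invf_plt ?posrE ?divr_gt0// truncnS_gt.
have kpos : 0 < k.+1%:R^-1 :> R by rewrite invr_gt0.
have /choice[q qP] : forall i, exists q : rat,
    ratr q \in `](x 0 i - k.+1%:R^-1), (x 0 i + k.+1%:R^-1)[.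
  move=> i.
  have [|q qP] := @rat_in_itvoo R (x 0 i - k.+1%:R^-1) (x 0 i + k.+1%:R^-1).
    by rewrite ltrD2l (lt_trans _ kpos)// oppr_lt0.
  by exists q.
move rE : (k.+1%:R^-1) => r in ke kpos qP.
exists (\row_i q i, k) => /=.
- move=> v /= vP; apply: xeU; split => // i j; rewrite ord1.
  rewrite /ball /=; move: (vP j) (qP j); rewrite mxE !in_itv/= rE.
  move=> /andP[v1 v2] /andP[q1 q2].
  by rewrite ltr_norml; apply/andP; split; lra.
- move=> i; move: (qP i); rewrite mxE !in_itv/= rE => /andP[q1 q2].
  by apply/andP; split; lra.
Qed.

Lemma measurable_fun_rV d (T : measurableType d) n (f : T -> rVBorel R n) :
  (forall i, measurable_fun [set: T] (fun x => (f x : 'rV[R]_n) 0 i)) ->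
  measurable_fun [set: T] f.
Proof.
move=> mf; apply: (@measurability _ _ T (rVBorel R n) setT f (@open 'rV[R]_n)) => //.
move=> _ [U oU <-]; rewrite setTI (open_ratboxE oU) preimage_bigcup.
rewrite bigcup_mkcond; apply: countable_bigcupT_measurable => // qk.
case: ifPn => // _.
rewrite (_ : f @^-1` _ = \bigcap_(i in [set: 'I_n])
    ((fun x => (f x : 'rV[R]_n) 0 i) @^-1`
      `](ratr (qk.1 0 i) - qk.2.+1%:R^-1), (ratr (qk.1 0 i) + qk.2.+1%:R^-1)[)).
  apply: fin_bigcap_measurable => // i _.
  by rewrite -[X in measurable X]setTI; apply: mf => //; exact: measurable_itv.
by apply/seteqP; split => [x xb i _|x xb i]; [exact: xb|exact: xb].
Qed.

Lemma continuous_measurable_rV n (f : 'rV[R]_n -> R) :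
  continuous f -> measurable_fun [set: rVBorel R n] (f : rVBorel R n -> R).
Proof.
move=> /continuousP cf; apply: (measurability _ (measurable_realfun.RGenOpens.measurableE R)).
move=> _ [U [x [y ->]] <-]; rewrite setTI.
by apply: sub_sigma_algebra; apply: cf; exact: interval_open.
Qed.

Definition cons_rV n (p : measurableTypeR R * rVBorel R n) : rVBorel R n.+1 :=
  row_mx (const_mx p.1 : 'rV[R]_1) (p.2 : 'rV[R]_n).

Definition uncons_rV n (v : rVBorel R n.+1) : measurableTypeR R * rVBorel R n :=
  ((lsubmx (v : 'rV[R]_(1 + n)) 0 0, rsubmx (v : 'rV[R]_(1 + n)))).

Lemma uncons_rVK n : cancel (@uncons_rV n) (@cons_rV n).
Proof.
move=> v; rewrite /cons_rV /uncons_rV /=.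
set w : 'rV[R]_(1 + n) := v.
have -> : const_mx (lsubmx w 0 0) = lsubmx w.
  by apply/matrixP => i j; rewrite mxE !ord1.
exact: (hsubmxK w).
Qed.

Lemma cons_rVK n : cancel (@cons_rV n) (@uncons_rV n).
Proof. by case=> x v; rewrite /uncons_rV row_mxKl row_mxKr mxE. Qed.

Lemma measurable_cons_rV n : measurable_fun setT (@cons_rV n).
Proof.
apply: measurable_fun_rV => i.
have [j ->|j ->] := split_ordP (i : 'I_(1 + n)).
  rewrite (_ : (fun _ => _) = fst)//.
  by apply/funext => x; apply: etrans (row_mxEl _ _ _ _) _; rewrite mxE.
rewrite (_ : (fun _ => _) = (fun v : rVBorel R n => (v : 'rV[R]_n) 0 j) \o snd).
  apply: measurableT_comp => //; apply: continuous_measurable_rV.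
  exact: coord_continuous.
by apply/funext => x; exact: row_mxEr.
Qed.

Lemma measurable_uncons_rV n : measurable_fun setT (@uncons_rV n).
Proof.
apply: measurable_fun_pair.
  rewrite (_ : (fun _ => _) =
    (fun v : rVBorel R n.+1 => (v : 'rV[R]_n.+1) 0 (lshift n 0 : 'I_(1 + n)))).
    by apply: continuous_measurable_rV; exact: coord_continuous.
  by apply/funext => v; rewrite mxE.
apply: measurable_fun_rV => i.
rewrite (_ : (fun _ => _) =
  (fun v : rVBorel R n.+1 => (v : 'rV[R]_n.+1) 0 (rshift 1 i : 'I_(1 + n)))).
  by apply: continuous_measurable_rV; exact: coord_continuous.
by apply/funext => v; rewrite mxE.
Qed.

(* The library's sigma-finite instance on m1 \x m2 is shadowed by the one for
   subprobabilities. *)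
Let sigma_finite_prod d1 d2 (T1 : measurableType d1) (T2 : measurableType d2)
    (m1 : {sigma_finite_measure set T1 -> \bar R})
    (m2 : {sigma_finite_measure set T2 -> \bar R}) :
  sigma_finite setT (m1 \x m2)%E.
Proof.
have /sigma_finiteP[F [TF ndF Foo]] := sigma_finiteT m1.
have /sigma_finiteP[G [TG ndG Goo]] := sigma_finiteT m2.
exists (fun n => F n `*` G n).
  rewrite -setXTT TF TG predeqE => -[x y]; split.
    move=> [/= [n _ Fnx] [k _ Gky]]; exists (maxn n k) => //; split.
    - by move: x Fnx; exact/subsetPset/ndF/leq_maxl.
    - by move: y Gky; exact/subsetPset/ndG/leq_maxr.
  by move=> [n _ []/= ? ?]; split; exists n.
move=> k; have [? ?] := Foo k; have [? ?] := Goo k.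
split; first exact: measurableX.
by rewrite product_measure1E// lte_mul_pinfty// ge0_fin_numE.
Qed.

Section step.
Variables (n : nat) (mu : {sigma_finite_measure set (rVBorel R n) -> \bar R}).

Definition lebesgue_rV_step : set (rVBorel R n.+1) -> \bar R :=
  pushforward (lebesgue_measure \x mu)%E (@cons_rV n).

HB.instance Definition _ := Measure.copy lebesgue_rV_step
  [the {measure set _ -> \bar R} of
    measure_function_pushforward__canonical__measure_function_Measure
    (lebesgue_measure \x mu)%E (@measurable_cons_rV n)].

Let lebesgue_rV_step_sigma_finite : sigma_finite setT lebesgue_rV_step.
Proof.
have [F FT Foo] : sigma_finite setT (lebesgue_measure \x mu)%E.
  exact: (sigma_finite_prod _ mu).
exists (fun i => @uncons_rV n @^-1` F i).
  by rewrite -preimage_bigcup -FT preimage_setT.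
move=> i; have [mF Fi] := Foo i; split.
  by rewrite -[X in measurable X]setTI; exact: measurable_uncons_rV.
rewrite /lebesgue_rV_step /pushforward -comp_preimage.
by rewrite (_ : _ \o _ = id) ?preimage_id//; apply/funext => p; exact: cons_rVK.
Qed.

HB.instance Definition _ := Measure_isSigmaFinite.Build _ _ _
  lebesgue_rV_step lebesgue_rV_step_sigma_finite.
End step.

(* Lebesgue measure on the Borel sets of R^n, as an iterated product measure;
   see lebesgue_rV_box. *)
Fixpoint lebesgue_rV n : {sigma_finite_measure set (rVBorel R n) -> \bar R} :=
  match n with
  | 0 => dirac (0 : rVBorel R 0)
  | n.+1 => lebesgue_rV_step (lebesgue_rV n)
  end.

Lemma lebesgue_rV_box n (A : 'I_n -> set (measurableTypeR R)) :
  (forall i, measurable (A i)) ->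
  lebesgue_rV n [set v : 'rV[R]_n | forall i, A i (v 0 i)] =
  (\prod_(i < n) lebesgue_measure (A i))%E.
Proof.
elim: n A => [|n IHn] A mA.
  by rewrite big_ord0 /= diracE mem_set// => -[].
rewrite big_ord_recl -(IHn (fun i => A (lift ord0 i)))//.
rewrite -product_measure1E//; last first.
  rewrite (_ : mkset _ = \bigcap_(i in [set: 'I_n])
      ((fun v : rVBorel R n => (v : 'rV[R]_n) 0 i) @^-1` A (lift ord0 i))).
    apply: fin_bigcap_measurable => // i _.
    have mi : measurable_fun [set: rVBorel R n]
        (fun v : rVBorel R n => (v : 'rV[R]_n) 0 i).
      by apply: continuous_measurable_rV; exact: coord_continuous.
    by rewrite -[X in measurable X]setTI; apply: mi => //; exact: mA.
  by apply/seteqP; split => [v vA i _|v vA i]; exact: vA.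
congr ((lebesgue_measure \x lebesgue_rV n)%E _).
have c0 (x : measurableTypeR R) (v : rVBorel R n) :
    (cons_rV (x, v) : 'rV[R]_n.+1) 0 ord0 = x.
  rewrite (_ : ord0 = lshift n (0 : 'I_1)); last exact: val_inj.
  by apply: etrans (row_mxEl _ _ _ _) _; rewrite mxE.
have cS (x : measurableTypeR R) (v : rVBorel R n) i :
    (cons_rV (x, v) : 'rV[R]_n.+1) 0 (lift ord0 i) = (v : 'rV[R]_n) 0 i.
  rewrite (_ : lift ord0 i = rshift 1 i); last exact: val_inj.
  exact: row_mxEr.
apply/seteqP; split => [[x v] /= vA|[x v] [/= xA vA] i].
  split; first by have := vA ord0; rewrite c0.
  by move=> i; have := vA (lift ord0 i); rewrite cS.
by have [j ->|->] := unliftP ord0 i; rewrite ?cS// c0.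
Qed.

End lebesgue_rV.

Section smooth_domain.
Context {R : realType} {n : nat}.
Implicit Types (Omega U : set 'rV[R]_n) (f rho : 'rV[R]_n -> R) (v w : 'rV[R]_n).

Definition dotv v w : R := \sum_(i < n) v 0 i * w 0 i.

Definition partial (i : 'I_n) f : 'rV[R]_n -> R :=
  fun x => 'D_('e_i) f x.

Definition grad f (x : 'rV[R]_n) : 'rV[R]_n := \row_i partial i f x.

Definition laplacian f (x : 'rV[R]_n) : R := \sum_(i < n) partial i (partial i f) x.

Definition boundary Omega : set 'rV[R]_n := closure Omega `\` interior Omega.

Definition bounded_domain Omega : Prop :=
  [/\ Omega !=set0, open Omega, connected Omega & bounded_set Omega].

(* Meaningful for U open: only pointwise continuity on U is required. *)
Fixpoint Ck (k : nat) U f : Prop :=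
  (forall x, U x -> {for x, continuous f}) /\
  (if k is k'.+1 then
     forall i : 'I_n, (forall x, U x -> derivable f x 'e_i) /\
                      Ck k' U (partial i f)
   else True).

Definition Cinfty U f : Prop := forall k, Ck k U f.

Definition defining_function Omega (x : 'rV[R]_n) U rho : Prop :=
  [/\ open U, U x, Cinfty U rho, forall y, U y -> grad rho y != 0 &
      forall y, U y -> (Omega y <-> rho y < 0)].

Definition smooth_boundary Omega : Prop :=
  forall x, boundary Omega x -> exists U rho, defining_function Omega x U rho.

(* Where the boundary is smooth, the outward normal is the normalized gradient
   of any local defining function that is negative inside Omega.  The library
   norm on 'rV[R]_n is the sup norm, hence the explicit Euclidean norm. *)
Definition unit_outward_normal Omega (nu : 'rV[R]_n -> 'rV[R]_n) : Prop :=
  forall x, boundary Omega x -> exists U rho, defining_function Omega x U rho /\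
    nu x = (Num.sqrt (dotv (grad rho x) (grad rho x)))^-1 *: grad rho x.

(* C^1 up to the boundary: the gradient in Omega extends continuously to the
   closure. *)
Definition C1_closure Omega f : Prop :=
  [/\ {within closure Omega, continuous f},
      forall x i, Omega x -> derivable f x 'e_i &
      exists G : 'rV[R]_n -> 'rV[R]_n, {within closure Omega, continuous G} /\
        forall x, Omega x -> G x = grad f x].

(* The gradient on the boundary is the limit of the gradient from inside. *)
Definition normal_derivative Omega (nu : 'rV[R]_n -> 'rV[R]_n) f
    (x : 'rV[R]_n) : R :=
  dotv (lim (grad f y @[y --> within Omega (nbhs x)])) (nu x).

End smooth_domain.

Section problem.
Context {R : realType} {n : nat}.
Variables (Omega : set 'rV[R]_n) (nu : 'rV[R]_n -> 'rV[R]_n).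
Implicit Types (T : R) (u : 'rV[R]_n -> R -> R).

Definition QT T : set ('rV[R]_n * R) := Omega `*` `]0, T[.

Definition ST T : set ('rV[R]_n * R) := boundary Omega `*` `]0, T[.

Definition GammaT T : set ('rV[R]_n * R) := ST T `|` (closure Omega `*` [set 0]).

Definition C21 T u : Prop :=
  [/\ {within QT T, continuous (fun z => u z.1 z.2)},
      (forall x t, QT T (x, t) -> derivable (u x) t 1) /\
        {within QT T, continuous (fun z => 'D_1 (u z.1) z.2)},
      forall i : 'I_n,
        (forall x t, QT T (x, t) -> derivable (u^~ t) x 'e_i) /\
        {within QT T, continuous (fun z => partial i (u^~ z.2) z.1)} &
      forall i j : 'I_n,
        (forall x t, QT T (x, t) ->
           derivable (partial i (u^~ t)) x 'e_j) /\
        {within QT T, continuous (fun z => partial j (partial i (u^~ z.2)) z.1)}].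

(* The domain QT `|` GammaT is closure Omega `*` [0, T[. *)
Definition C10 T u : Prop :=
  [/\ {within QT T `|` GammaT T, continuous (fun z => u z.1 z.2)},
      forall x t i, Omega x -> 0 <= t < T -> derivable (u^~ t) x 'e_i &
      exists G : 'rV[R]_n * R -> 'rV[R]_n,
        {within QT T `|` GammaT T, continuous G} /\
        forall x t, Omega x -> 0 <= t < T -> G (x, t) = grad (u^~ t) x].

(* `^ is the real power, with 0 `^ 0 = 1. *)
Definition nonlocal_flux (l : R) (k : 'rV[R]_n -> 'rV[R]_n -> R -> R) (t : R)
    (f : 'rV[R]_n -> R) (x : 'rV[R]_n) : R :=
  (\int[lebesgue_rV n]_(y in Omega) (k x y t * f y `^ l)).

Definition admissible_datum (l : R) (k : 'rV[R]_n -> 'rV[R]_n -> R -> R)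
    (u0 : 'rV[R]_n -> R) : Prop :=
  [/\ C1_closure Omega u0, forall x, Omega x -> 0 <= u0 x &
      forall x, boundary Omega x ->
        normal_derivative Omega nu u0 x = nonlocal_flux l k 0 u0 x].

Definition is_solution (p q m l a b : R) (k : 'rV[R]_n -> 'rV[R]_n -> R -> R)
    (u0 : 'rV[R]_n -> R) T u : Prop :=
  [/\ forall x t, (QT T `|` GammaT T) (x, t) -> 0 <= u x t,
      C21 T u /\ C10 T u,
      forall x t, QT T (x, t) ->
        'D_1 (u x) t = laplacian (u^~ t) x
          + a * u x t `^ p *
            (\int[lebesgue_measure]_(s in `[0, t]) (u x s `^ q))
          - b * u x t `^ m,
      forall x t, ST T (x, t) ->
        normal_derivative Omega nu (u^~ t) x = nonlocal_flux l k t (u^~ t) x &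
      forall x, Omega x -> u x 0 = u0 x].

End problem.

(* Main.v *)
(* The proof is a maximum principle. The difference [u - v] of two solutions
   is compared with [mu * expR (lam * t) * phi x], where [phi] takes its values
   in [1, 2] but has an arbitrarily large normal derivative on the boundary, so
   that it beats the nonlocal flux, while a large [lam] beats the reaction and
   memory terms; [- b u^m] has the right sign because [u^m] is monotone. This
   only needs bounds |u^r - v^r| <= L |u - v| for r = p, q, l: they hold when
   r >= 1, and for every r >= 0 as soon as one of the two solutions is bounded
   away from 0 (the other one may vanish). In case (iii) such a lower bound
   comes from a similar comparison; when p < m < 1, the memory term, which is
   bounded below after a short time, dominates the absorption for small u. *)
Require Import Defs.
From mathcomp Require Import all_boot all_order all_algebra.
From mathcomp Require Import all_classical all_reals all_analysis.
From mathcomp Require Import lra ring.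

Set Implicit Arguments.
Unset Strict Implicit.
Unset Printing Implicit Defensive.

Import Order.TTheory GRing.Theory Num.Theory.
Import numFieldNormedType.Exports.

Local Open Scope classical_set_scope.
Local Open Scope ring_scope.

(** * Directional derivatives *)

(** The boundary is known only through local defining functions, and [nu] is the normalised gradient
    of one that may change from point to point; no continuity of [nu] is assumed. The remedy is that
    two defining functions have positively proportional gradients at a common boundary point, so
    [nu] can be tested against any of them. Cut off by bumps of class C^2 and summed over a finite
    cover, they give a function [rho] that is nonpositive on the closure, zero on the boundary, with
    normal derivative at least some [c > 0]; the steep [phi] is [1 + expR (K * rho)]. The upper
    bound 2 on [phi] matters because flux and memory are nonlocal: they see [u - v] at other points
    and earlier times, where it is at most [2 * E], with [E] the value of [mu * expR (lam * t)] at
    the touching time. Since the slope of [phi] exceeds what the flux needs by a strict margin, the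
    plain first-order condition at a boundary maximum suffices, without Hopf's lemma. Solutions are
    controlled only before [T], so each argument runs on a compact cylinder ending at some [t1 < T],
    where extrema are attained. *)

Section lines.
Context {R : realType} {V : normedModType R}.

Lemma is_derive_line (f : V -> R) (x v : V) (s d : R) :
  is_derive (s *: v + x) v f d ->
  is_derive s 1 (fun r : R => f (r *: v + x)) d.
Proof.
move=> [fd <-].
have E : (fun h : R => h^-1 *: (f (h *: v + (s *: v + x)) - f (s *: v + x))) =
  (fun h : R => h^-1 *: (f ((h *: 1 + s) *: v + x) - f (s *: v + x))).
  apply/funext => h; congr (_ *: (f _ - _)).
  by rewrite scalerDl addrA /GRing.scale /= mulr1.
apply: DeriveDef; first by rewrite /derivable -E.
by rewrite /derive -E.
Qed.

Lemma derive_line (f : V -> R) (x v : V) (d : R) :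
  is_derive (0 : R) 1 (fun r : R => f (r *: v + x)) d -> is_derive x v f d.
Proof.
move=> [fd <-].
have E : (fun h : R => h^-1 *: (f (h *: v + x) - f x)) =
  (fun h : R => h^-1 *: (f ((h *: 1 + 0 : R) *: v + x) - f ((0 : R) *: v + x))).
  apply/funext => h; congr (_ *: (f _ - f _)); last by rewrite scale0r add0r.
  by rewrite addr0 /GRing.scale /= mulr1.
apply: DeriveDef; first by rewrite /derivable E.
by rewrite /derive E.
Qed.

Lemma cvg_line (x v : V) : (fun s : R => s *: v + x) @ (0 : R) --> x.
Proof.
rewrite -[in X in _ --> X](add0r x) -[in X in _ --> X](scale0r v).
by apply: cvgD; [apply: cvgZ; [exact: cvg_id|exact: cvg_cst]|exact: cvg_cst].
Qed.

(* Adding one coordinate direction at a time, this gives all the directional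
   derivatives of a function with continuous partial derivatives. *)
Lemma is_derive_addv (f g : V -> R) (x w e : V) (c d : R) :
  is_derive x w f d ->
  (\forall y \near x, is_derive y e f (g y)) -> {for x, continuous g} ->
  is_derive x (w + c *: e) f (d + c * g x).
Proof.
move=> [fd dfE] /nbhs_ballP[r /= r0 rfg] cg.
have cvw : h^-1 *: (f (h *: w + x) - f x) @[h --> 0^'] --> d.
  by rewrite -dfE; exact: fd.
suff H : h^-1 *: (f (h *: (w + c *: e) + x) - f x) @[h --> 0^'] --> d + c * g x.
  apply: DeriveDef; first by apply/cvg_ex; eexists; exact: H.
  exact: cvg_lim H.
(* The increment is split at [h *: w + x]: the first leg is the hypothesis on [w], the second runs
   along [e], where the mean value theorem turns it into [h * c] times a value of [g] near [x]. *)
rewrite (_ : (fun h => _) = (fun h : R => h^-1 *: (f (h *: w + x) - f x) +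
  h^-1 *: (f (h *: (w + c *: e) + x) - f (h *: w + x)))); last first.
  by apply/funext => h; rewrite -scalerDr; congr (_ *: _); rewrite [RHS]addrC subrKA.
apply: cvgD => //.
apply/cvgrPdist_lt => eps eps0.
pose eta := eps / (`|c| + 1).
have c1 : 0 < `|c| + 1 by rewrite ltr_wpDl.
have eta0 : 0 < eta by rewrite divr_gt0.
have /nbhs_ballP[r' /= r'0 r'g] : \forall y \near x, `|g x - g y| < eta.
  by move/cvgrPdist_lt : cg => /(_ _ eta0).
pose rr := Num.min r r'.
have rr0 : 0 < rr by rewrite lt_min r0.
(* The norm of [h] times [B] dominates the distance from [x] to every point of the second leg, so
   that leg stays where [f] is differentiable along [e] and [g] varies by less than [eta]. *)
pose B := `|w| + `|c| * `|e| + 1.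
have B0 : 0 < B by rewrite ltr_wpDl// addr_ge0// mulr_ge0.
near=> h.
have h0 : h != 0 by near: h; exact: nbhs_dnbhs_neq.
have hB : `|h| * B < rr.
  rewrite -ltr_pdivlMr//; near: h; apply: dnbhs0_lt; exact: divr_gt0.
pose P s := (s * (h * c)) *: e + (h *: w + x).
have Pball (s : R) : s \in `[0, 1]%R -> ball x rr (P s).
  rewrite in_itv /= => /andP[s0 s1].
  rewrite -ball_normE /= /P addrA opprD addrCA subrr addr0 normrN.
  apply: le_lt_trans hB.
  apply: (le_trans (ler_normD _ _)); rewrite !normrZ (ger0_norm s0) /B.
  have : s * (`|h| * `|c|) * `|e| <= `|h| * (`|c| * `|e|).
    rewrite -!mulrA ler_piMl// !mulr_ge0//.
  have := normr_ge0 h; nra.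
have dP (s : R) : s \in `[0, 1]%R ->
    is_derive s 1 (fun s => f (P s)) (h * c * g (P s)).
  move=> s01.
  have /rfg fgP : ball x r (P s).
    by apply: le_ball (Pball _ s01); rewrite ge_min lexx.
  have /is_derive_line : is_derive (s *: ((h * c) *: e) + (h *: w + x))
      ((h * c) *: e) f (h * c * g (P s)).
    rewrite scalerA -/(P s); apply: derive_line.
    have -> : (fun r0 => f (r0 *: ((h * c) *: e) + P s)) =
        (fun r0 => f (r0 *: e + P s)) \o (fun r0 => (h * c) * r0).
      by apply/funext => y /=; rewrite scalerA [y * _]mulrC.
    have Z : is_derive (h * c * 0) 1 (fun r0 => f (r0 *: e + P s)) (g (P s)).
      by apply: is_derive_line; rewrite mulr0 scale0r add0r.
    apply: is_derive_eq.
    by rewrite [LHS]mulrC [_ *: 1]mulr1.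
  by under eq_fun do rewrite scalerA.
have dPo (s : R) : s \in `]0, 1[%R ->
    is_derive s 1 (fun s => f (P s)) (h * c * g (P s)).
  by rewrite in_itv /= => /andP[s0 s1]; apply: dP; rewrite in_itv /= !ltW.
have cP : {within `[0, 1], continuous (fun s => f (P s))}.
  by apply: derivable_within_continuous => s s01; case: (dP _ s01).
have [xi xi01 fE] := MVT_segment ler01 dPo cP.
move: fE; rewrite subr0 mulr1 /P !mul0r scale0r add0r mul1r => fE.
rewrite (_ : h *: (w + c *: e) + x = (h * c) *: e + (h *: w + x)); last first.
  by rewrite scalerDr scalerA addrA [_ + h *: w]addrC.
rewrite fE -/(P xi) /GRing.scale /= -!mulrA mulKf// -mulrBr normrM.
have : `|g x - g (P xi)| < eta.
  by apply: r'g; apply: le_ball (Pball _ xi01); rewrite ge_min lexx orbT.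
move=> H; apply: (@le_lt_trans _ _ (`|c| * eta)).
  by rewrite ler_wpM2l// ltW.
rewrite /eta mulrA ltr_pdivrMr// mulrC ltr_pM2l//.
by rewrite ltrDl.
Unshelve. all: by end_near. Qed.

End lines.

Section directional.
Context {R : realType} {n : nat}.
Implicit Types (f : 'rV[R]_n -> R) (x v : 'rV[R]_n).

Lemma is_derive_partials f (g : 'I_n -> 'rV[R]_n -> R) x v :
  (forall i, \forall y \near x, is_derive y 'e_i f (g i y)) ->
  (forall i, {for x, continuous (g i)}) ->
  is_derive x v f (\sum_(i < n) v 0 i * g i x).
Proof.
move=> fg cg; rewrite [v in is_derive x v](row_sum_delta v).
elim: (index_enum _) => [|i s ih]; first by rewrite !big_nil; exact: is_derive0.
by rewrite !big_cons addrC [X in is_derive _ _ _ X]addrC; exact: is_derive_addv.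
Qed.

End directional.

(** * One-variable and second-derivative tests *)

Lemma within_continuous_comp_in {T U V : topologicalType} (A : set T) (B : set U)
    (f : T -> U) (g : U -> V) :
  (forall x, A x -> B (f x)) ->
  {within A, continuous f} -> {within B, continuous g} ->
  {within A, continuous (g \o f)}.
Proof.
move=> AB /subspace_continuousP cf /subspace_continuousP cg.
apply/subspace_continuousP => x Ax.
apply: cvg_comp (cg _ (AB _ Ax)) => W /= BW.
have := cf _ Ax _ BW; rewrite /nbhs /= => H.
by near=> y; apply: (near H y) => //; apply: AB; near: y; exact: withinT.
Unshelve. all: by end_near. Qed.

Section one_variable.
Context {R : realType}.

Lemma derive_sign (f : R -> R) (t d : R) : is_derive t 1 f d ->
  forall e : R, 0 < e -> \forall h \near 0^',
    `|d - h^-1 * (f (h + t) - f t)| < e.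
Proof.
move=> [fd <-] e e0; move/cvgrPdist_lt : fd => /(_ _ e0).
by apply: filterS => h; rewrite /GRing.scale /= mulr1.
Qed.

(** One-sided on purpose: the touching time may be the last time of the cylinder, so only earlier
    times can be compared. *)
Lemma derive_ge0_left_max (f : R -> R) (t d e : R) : 0 < e ->
  is_derive t 1 f d -> (forall s, t - e < s < t -> f s <= f t) -> 0 <= d.
Proof.
move=> e0 /derive_sign fd fmax; rewrite leNgt; apply/negP => d0.
have /fd : 0 < - d by rewrite oppr_gt0.
case=> r /= r0 rd.
pose h := - (Num.min r e / 2).
have m0 : 0 < Num.min r e by rewrite lt_min r0.
have hr : Num.min r e <= r by rewrite ge_min lexx.
have he : Num.min r e <= e by rewrite ge_min lexx orbT.
have h0 : h < 0 by rewrite oppr_lt0 divr_gt0.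
have /rd/(_ _) : ball_ Num.Def.normr 0 r h.
  by rewrite /= sub0r normrN ler0_norm ?ltW// opprK; lra.
rewrite lt_eqF// => /(_ isT); rewrite ltr_norml => /andP[H _].
have : 0 <= h^-1 * (f (h + t) - f t).
  rewrite nmulr_rge0 ?invr_lt0// subr_le0; apply: fmax.
  by rewrite /h; apply/andP; split; lra.
lra.
Qed.

Lemma derive_le0_left_min (f : R -> R) (t d e : R) : 0 < e ->
  is_derive t 1 f d -> (forall s, t - e < s < t -> f t <= f s) -> d <= 0.
Proof.
move=> e0 fd fmin; rewrite -oppr_ge0.
apply: (@derive_ge0_left_max (- f) t _ e e0) => s /fmin.
by rewrite lerN2.
Qed.

Lemma derive_right_lt (f : R -> R) (t d : R) : is_derive t 1 f d -> 0 < d ->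
  \forall s \near 0^'+, f t < f (s + t).
Proof.
move=> /derive_sign fd d0; have [r /= r0 rd] := fd _ d0.
near=> s.
have s0 : 0 < s by near: s; exact: nbhs_right_gt.
have /rd/(_ _) : ball_ Num.Def.normr 0 r s.
  by rewrite /= sub0r normrN gtr0_norm//; near: s; exact: nbhs_right_lt.
rewrite gt_eqF// => /(_ isT); rewrite ltr_norml => /andP[_ H].
have : 0 < s^-1 * (f (s + t) - f t) by lra.
by rewrite pmulr_rgt0 ?invr_gt0// subr_gt0.
Unshelve. all: by end_near. Qed.

End one_variable.

Section second_derivative.
Context {R : realType} {V : normedModType R}.

Lemma near_line (x v : V) (P : set V) : nbhs x P ->
  exists2 r : R, 0 < r & forall s : R, `|s| < r -> P (s *: v + x).
Proof.
move=> xP; have /cvg_line : nbhs x P by [].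
move=> /(_ v) /nbhs_ballP[r /= r0 rP]; exists r => // s sr.
by apply: rP; rewrite -ball_normE /= sub0r normrN.
Qed.

(** Everything is read along the line through [x]. If [h > 0], then [g], which vanishes at [x], is
    positive just after it, and the mean value theorem makes [f] exceed [f x] there. *)
Lemma derive2_max (f g : V -> R) (x v : V) (h : R) :
  (\forall y \near x, is_derive y v f (g y)) -> is_derive x v g h ->
  (\forall y \near x, f y <= f x) -> g x = 0 /\ h <= 0.
Proof.
move=> fg gh fmax.
have [r r0 rP] := near_line v (filterI fg fmax).
pose F (s : R) := f (s *: v + x); pose G (s : R) := g (s *: v + x).
have FG (s : R) : `|s| < r -> is_derive s 1 F (G s).
  by move=> /rP[H _]; exact: is_derive_line.
have r2 (s : R) : s \in `](- r), r[%R -> `|s| < r.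
  by rewrite in_itv /= ltr_norml.
have g0 : g x = 0.
  have : is_derive (0 : R) 1 F 0.
    apply: (@derive1_at_max _ _ (- r) r) => //.
    - by rewrite lerNl (le_trans _ (ltW r0))// oppr_le0 ltW.
    - by move=> s /r2 /FG[].
    - by rewrite in_itv /= oppr_lt0 r0.
    - by move=> s /r2 /rP[_]; rewrite /F scale0r add0r.
  have [_ F0] : is_derive (0 : R) 1 F (G 0) by apply: FG; rewrite normr0.
  by move=> [_]; rewrite F0 /G scale0r add0r.
split=> //; rewrite leNgt; apply/negP => h0.
have Gh : is_derive (0 : R) 1 G h.
  by apply: is_derive_line; rewrite scale0r add0r.
have [s [s0 sr Gs]] : exists s, [/\ 0 < s, s < r &
    forall s', 0 < s' -> s' <= s -> 0 < G s'].
  have [e /= e0 eG] := derive_right_lt Gh h0.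
  pose m := Num.min e r; have m0 : 0 < m by rewrite lt_min e0.
  have me : m <= e by rewrite ge_min lexx.
  have mr : m <= r by rewrite ge_min lexx orbT.
  exists (m / 2); split; [by rewrite divr_gt0|by lra|] => s' s'0 s'm.
  have := eG s'; rewrite /= sub0r normrN gtr0_norm// => /(_ _ s'0).
  by rewrite addr0 {1}/G scale0r add0r g0; apply; lra.
have Fo (y : R) : y \in `]0, s[%R -> is_derive y 1 F (G y).
  rewrite in_itv /= => /andP[y0 ys]; apply: FG.
  by rewrite gtr0_norm// (lt_trans ys).
have cF : {within `[0, s], continuous F}.
  apply: derivable_within_continuous => y; rewrite in_itv /= => /andP[y0 ys].
  have : `|y| < r by rewrite ger0_norm// (le_lt_trans ys).
  by move=> /FG[].
have [xi] := MVT s0 Fo cF.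
rewrite in_itv /= => /andP[xi0 xis] E.
have : F s <= F 0.
  have : `|s| < r by rewrite gtr0_norm.
  by move=> /rP[_]; rewrite {2}/F scale0r add0r.
rewrite -subr_le0 E subr0 leNgt mulr_gt0//; apply: Gs => //; exact: ltW.
Qed.

End second_derivative.

(** * Twice differentiable functions *)

Section C2_diagonal.
Context {R : realType} {n : nat}.
Implicit Types (f : 'rV[R]_n -> R) (g h : 'I_n -> 'rV[R]_n -> R).

(* [g i] and [h i] are the first and the unmixed second partial derivatives. *)
Definition C2at f g h (x : 'rV[R]_n) :=
  {for x, continuous f} /\ forall i,
    [/\ {for x, continuous (g i)}, {for x, continuous (h i)},
        is_derive x 'e_i f (g i x) & is_derive x 'e_i (g i) (h i x)].

(** Locality is what allows a product with a cutoff to be treated as zero where its other factor has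
    no known regularity. *)
Lemma near_C2at f g h f' g' h' x :
  (\forall y \near x, f y = f' y) ->
  (forall i, \forall y \near x, g i y = g' i y) ->
  (forall i, \forall y \near x, h i y = h' i y) ->
  C2at f g h x -> C2at f' g' h' x.
Proof.
have nc (F G : 'rV[R]_n -> R) : (\forall y \near x, F y = G y) ->
    {for x, continuous F} -> {for x, continuous G}.
  move=> FG cF; rewrite /prop_for /continuous_at -(nbhs_singleton FG).
  by apply: cvg_trans cF; exact: near_eq_cvg FG.
move=> ff gg hh [cf C]; split; first exact: nc cf.
move=> i; have [cg ch df dg] := C i; split; [exact: nc cg|exact: nc ch| |].
  by rewrite -(nbhs_singleton (gg i)); exact: near_eq_is_derive df.
by rewrite -(nbhs_singleton (hh i)); exact: near_eq_is_derive dg.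
Unshelve. all: by end_near. Qed.

Lemma C2at_cst (c : R) x : C2at (fun=> c) (fun _ _ => 0) (fun _ _ => 0) x.
Proof.
split=> [|i]; first exact: cst_continuous.
by split; [exact: cst_continuous|exact: cst_continuous|
  exact: is_derive_cst|exact: is_derive_cst].
Qed.

Lemma C2at_add f g h f' g' h' x : C2at f g h x -> C2at f' g' h' x ->
  C2at (fun y => f y + f' y) (fun i y => g i y + g' i y)
       (fun i y => h i y + h' i y) x.
Proof.
move=> [cf C] [cf' C']; split=> [|i]; first exact: continuousD.
have [? ? ? ?] := C i; have [? ? ? ?] := C' i.
by split; [exact: continuousD|exact: continuousD|exact: is_deriveD|exact: is_deriveD].
Qed.

Lemma C2at_mul f g h f' g' h' x : C2at f g h x -> C2at f' g' h' x ->
  C2at (fun y => f y * f' y) (fun i y => f y * g' i y + f' y * g i y)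
       (fun i y => f y * h' i y + f' y * h i y + 2 * g i y * g' i y) x.
Proof.
move=> [cf C] [cf' C']; split=> [|i]; first exact: continuousM.
have [cg ch df dg] := C i; have [cg' ch' df' dg'] := C' i.
split.
- by apply: continuousD; exact: continuousM.
- apply: continuousD; first by apply: continuousD; exact: continuousM.
  by apply: continuousM => //; apply: continuousM => //; exact: cst_continuous.
- exact: is_deriveM.
- apply: is_derive_eq.
  rewrite /GRing.scale /=; ring.
Qed.

Lemma C2at_comp (F F' F'' : R -> R) f g h x : C2at f g h x ->
  (\forall y \near x, is_derive (f y) 1 F (F' (f y))) ->
  {for f x, continuous F'} ->
  is_derive (f x) 1 F' (F'' (f x)) -> {for f x, continuous F''} ->
  C2at (fun y => F (f y)) (fun i y => F' (f y) * g i y)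
       (fun i y => F'' (f y) * g i y ^+ 2 + F' (f y) * h i y) x.
Proof.
move=> [cf C] /nbhs_singleton dF cF' dF' cF''.
have chain (G : R -> R) (d e : R) i : is_derive (f x) 1 G d ->
    is_derive x 'e_i f e -> is_derive x 'e_i (fun y => G (f y)) (d * e).
  move=> dG df; apply: derive_line.
  have L : is_derive (0 : R) 1 (fun s : R => f (s *: 'e_i + x)) e.
    by apply: is_derive_line; rewrite scale0r add0r.
  by apply: is_derive1_comp; rewrite scale0r add0r.
split.
  apply: (@continuous_comp _ _ _ f F) => //.
  by apply/differentiable_continuous/derivable1_diffP; case: dF.
move=> i; have [cg ch df dg] := C i.
have cF'f : {for x, continuous (fun y => F' (f y))} by exact: continuous_comp.
have cF''f : {for x, continuous (fun y => F'' (f y))} by exact: continuous_comp.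
split.
- exact: continuousM.
- apply: continuousD; last exact: continuousM.
  by apply: continuousM => //; exact: continuousM.
- exact: chain.
- have H := chain _ _ _ i dF' df.
  apply: is_derive_eq; rewrite /GRing.scale /=; ring.
Qed.

Lemma C2at_coord j x :
  C2at (fun y => y 0 j) (fun i _ => (i == j)%:R) (fun _ _ => 0) x.
Proof.
split=> [|i]; first exact: coord_continuous.
split; [exact: cst_continuous|exact: cst_continuous| |exact: is_derive_cst].
apply: derive_line.
rewrite (_ : (fun _ => _) = (fun r : R => r * (i == j)%:R + x 0 j)); last first.
  by apply/funext => r; rewrite !mxE eqxx /= eq_sym.
by apply: is_derive_eq; rewrite /GRing.scale /= mulr0 add0r mulr1 addr0.
Qed.

End C2_diagonal.

(** * A cutoff of class C^2 *)

Section bump.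
Context {R : realType}.

Lemma continuous_pos_part_exp (k : nat) : continuous (fun s : R => Num.max 0 s ^+ k).
Proof.
move=> h; apply: (@continuous_comp _ _ _ (fun s : R => Num.max 0 s)
  (fun t : R => t ^+ k)).
  by apply: (@continuous_max R R); [exact: cst_continuous|exact: cvg_id].
exact: exprn_continuous.
Qed.

(** Serves at the kink 0 of [Num.max 0 s ^+ k.+2], which is [s] times the next lower power: the
    difference quotient at 0 is [phi] itself. *)
Lemma is_derive_factor0 (f phi : R -> R) :
  (forall s, f s = s * phi s) -> {for 0, continuous phi} ->
  is_derive (0 : R) 1 f (phi 0).
Proof.
move=> fE cphi.
have H : (fun h : R => h^-1 *: (f (h *: (1 : R) + 0) - f 0)) @ (0 : R)^' --> phi 0.
  have cphi' : phi @ (0 : R)^' --> phi 0 by exact: cvg_within_filter cphi.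
  apply: cvg_trans cphi'; apply: near_eq_cvg; near=> h.
  have h0 : h != 0 by near: h; exact: nbhs_dnbhs_neq.
  by rewrite addr0 !fE mul0r subr0 /GRing.scale /= mulr1 mulKf.
by apply: DeriveDef; [apply/cvg_ex; exists (phi 0)|exact: cvg_lim H].
Unshelve. all: by end_near. Qed.

Lemma is_derive_pos_part_exp (k : nat) (s : R) :
  is_derive s 1 (fun s => Num.max 0 s ^+ k.+2) (k.+2%:R * Num.max 0 s ^+ k.+1).
Proof.
have [s0|] := boolP (s < 0); last first.
  rewrite -leNgt le_eqVlt => /predU1P[<-|s0].
    have -> : k.+2%:R * Num.max 0 0 ^+ k.+1 = Num.max 0 0 ^+ k.+1 :> R.
      by rewrite maxxx expr0n mulr0.
    apply: is_derive_factor0 (@continuous_pos_part_exp k.+1 0) => s0.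
    rewrite exprS; have [_|_] := leP 0 s0; rewrite ?mulr1//.
    by rewrite !expr0n !mulr0.
  rewrite max_r ?ltW//.
  apply: (@near_eq_is_derive R R R (fun t : R => t ^+ k.+2)).
    near=> t; rewrite max_r//; apply: ltW; near: t; exact: lt_nbhsr.
  have := is_deriveX k.+2 (is_derive_id s (1 : R)).
  by rewrite exprfctE /GRing.scale /= mulr1.
rewrite max_l ?ltW// expr0n /= mulr0.
apply: (@near_eq_is_derive R R R (cst 0)).
near=> t; rewrite max_l ?expr0n//; apply: ltW; near: t; exact: lt_nbhsl.
Unshelve. all: by end_near. Qed.

Context {n : nat}.

Lemma C2_sum (s : seq 'I_n) (f : 'I_n -> 'rV[R]_n -> R) :
  (forall j, exists g h, forall x, C2at (f j) g h x) ->
  exists g h, forall x, C2at (fun y => \sum_(j <- s) f j y) g h x.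
Proof.
move=> Hf; elim: s => [|j s [g [h ih]]].
  exists (fun _ _ => 0), (fun _ _ => 0) => x.
  by under eq_fun do rewrite big_nil; exact: C2at_cst.
have [g' [h' H]] := Hf j.
eexists; eexists => x; under eq_fun do rewrite big_cons.
exact: C2at_add (H x) (ih x).
Qed.

(** The cube is the least natural power of the positive part with a continuous second derivative,
    which is all that [C2at] asks. The Euclidean square is used because the sup norm of ['rV[R]_n]
    is not differentiable. *)
Definition cubic_bump (r : R) (y x : 'rV[R]_n) : R :=
  Num.max 0 (r ^+ 2 - \sum_(j < n) (x 0 j - y 0 j) ^+ 2) ^+ 3.

Lemma C2_cubic_bump r y : exists g h,
  (forall x, C2at (cubic_bump r y) g h x).
Proof.
have [gs [hs H]] : exists g h, forall x,
    C2at (fun x : 'rV[R]_n => \sum_(j < n) - 1 * (x 0 j - y 0 j) ^+ 2) g h x.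
  apply: C2_sum => j; eexists; eexists => x.
  apply: C2at_mul (C2at_cst _ _) _.
  apply: C2at_mul; apply: C2at_add (C2at_coord _ _) (C2at_cst _ _).
eexists; eexists => x; rewrite /cubic_bump.
have E : (fun x : 'rV[R]_n => r ^+ 2 - \sum_(j < n) (x 0 j - y 0 j) ^+ 2) =
    (fun x => r ^+ 2 + \sum_(j < n) - 1 * (x 0 j - y 0 j) ^+ 2).
  by apply/funext => z; rewrite -mulr_sumr mulN1r.
have W := C2at_add (C2at_cst (r ^+ 2) x) (H x).
rewrite -E in W.
apply: (@C2at_comp R n (fun s => Num.max 0 s ^+ 3)
  (fun s => 3%:R * Num.max 0 s ^+ 2) (fun s => 3%:R * (2%:R * Num.max 0 s ^+ 1))).
- exact: W.
- by near=> z; exact: is_derive_pos_part_exp.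
- apply: (@continuousM R R); first exact: cst_continuous.
  exact: continuous_pos_part_exp.
- by apply: is_deriveZ; exact: is_derive_pos_part_exp.
- apply: (@continuousM R R); first exact: cst_continuous.
  apply: (@continuousM R R); first exact: cst_continuous.
  exact: continuous_pos_part_exp.
Unshelve. all: by end_near. Qed.

Lemma cubic_bump_ge0 r y x : 0 <= cubic_bump r y x.
Proof. by rewrite /cubic_bump exprn_ge0// le_max lexx. Qed.

Lemma cubic_bump_gt0 r y : 0 < r -> 0 < cubic_bump r y y.
Proof.
move=> r0; rewrite /cubic_bump big1 => [|j _]; last by rewrite subrr expr0n.
by rewrite subr0 exprn_gt0// lt_max exprn_gt0// orbT.
Qed.

(** Balls are those of the sup norm: outside [ball y (r * 2)] some coordinate differs by at least
    [r * 2], so the Euclidean distance strictly exceeds [r], and this strict inequality persists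
    near [x]. *)
Lemma cubic_bump_near0 r y x : 0 < r -> ~ ball y (r * 2) x ->
  \forall z \near x, cubic_bump r y z = 0.
Proof.
move=> r0 xy.
have cw : {for x, continuous (fun x : 'rV[R]_n => \sum_(j < n) (x 0 j - y 0 j) ^+ 2)}.
  have [g' [h' H]] : exists g h, forall x,
    C2at (fun x : 'rV[R]_n => \sum_(j < n) (x 0 j - y 0 j) ^+ 2) g h x.
    apply: C2_sum => j; eexists; eexists => z.
    by apply: C2at_mul; apply: C2at_add (C2at_coord _ _) (C2at_cst _ _).
  by case: (H x).
have [j jr] : exists j, r * 2 <= `|x 0 j - y 0 j|.
  apply/not_existsP => xyr; apply: xy; split; first by rewrite mulr_gt0.
  move=> i j; rewrite ord1 /ball /= distrC ltNge; apply/negP; exact: xyr.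
have : r ^+ 2 < \sum_(j < n) (x 0 j - y 0 j) ^+ 2.
  rewrite (bigD1 j)//= ltr_wpDr ?sumr_ge0//; first by move=> i _; exact: sqr_ge0.
  by rewrite -(real_normK (num_real (x 0 j - y 0 j))) ltr_pXn2r ?nnegrE ?(ltW r0)//; lra.
move=> /(cvgr_gt _ cw); apply: filterS => z zr.
by rewrite /cubic_bump max_l ?expr0n// subr_le0 ltW.
Qed.

End bump.

(** * The barrier *)

(** Compactness as an induction principle: the sets with [P] form an ideal, so a finite subcover by
    such sets suffices. It glues the local barriers without a partition of unity. *)
Lemma compact_ind {T : ptopologicalType} (P : set T -> Prop) (K : set T) :
  P set0 -> (forall A B, P A -> P B -> P (A `|` B)) ->
  (forall A B, A `<=` B -> P B -> P A) -> compact K ->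
  (forall x, K x -> exists2 V, nbhs x V & P V) -> P K.
Proof.
move=> P0 PU PS; rewrite compact_cover => Kc KP.
have /choice[V HV] x : exists V, K x -> nbhs x V /\ P V.
  have [Kx|nKx] := pselect (K x); last by exists set0.
  by have [V] := KP _ Kx; exists V.
have [||D DK] := @Kc T K (fun x => (V x)^°).
- by move=> x _; exact: open_interior.
- by move=> x Kx; exists x => //; exact: (HV x Kx).1.
move=> /PS; apply.
have {DK} : forall x, x \in finmap.enum_fset D -> K x by move=> x /DK; rewrite inE.
rewrite /cover (bigcup_seq (finmap.enum_fset D)).
elim: (finmap.enum_fset D) => [|x s ih] sK; first by rewrite big_nil.
rewrite big_cons; apply: PU; last by apply: ih => y ys; apply: sK; rewrite inE ys orbT.
apply: PS; first exact: interior_subset.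
by have [] := HV x (sK _ (mem_head _ _)).
Qed.

Section dotv.
Context {R : realType} {n : nat}.
Implicit Types v w : 'rV[R]_n.

Lemma dotvC v w : dotv v w = dotv w v.
Proof. by apply: eq_bigr => i _; rewrite mulrC. Qed.

Lemma dotvDl v v' w : dotv (v + v') w = dotv v w + dotv v' w.
Proof. by rewrite -big_split; apply: eq_bigr => i _; rewrite mxE mulrDl. Qed.

Lemma dotvZl c v w : dotv (c *: v) w = c * dotv v w.
Proof. by rewrite mulr_sumr; apply: eq_bigr => i _; rewrite mxE mulrA. Qed.

Lemma dotvDr v w w' : dotv v (w + w') = dotv v w + dotv v w'.
Proof. by rewrite dotvC dotvDl !(dotvC v). Qed.

Lemma dotvZr c v w : dotv v (c *: w) = c * dotv v w.
Proof. by rewrite dotvC dotvZl dotvC. Qed.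

Lemma dotv_gt0 v : v != 0 -> 0 < dotv v v.
Proof.
move=> v0; have v2 i : 0 <= v 0 i * v 0 i by rewrite -expr2 sqr_ge0.
rewrite lt_neqAle sumr_ge0// andbT eq_sym; apply: contra v0.
rewrite psumr_eq0// => /allP v00; apply/eqP/rowP => i; rewrite mxE.
by apply/eqP; have := v00 i (mem_index_enum _); rewrite mulf_eq0 orbb.
Qed.

End dotv.

Lemma continuous_at_sum {R : realType} {T : topologicalType} {I : Type}
    (s : seq I) (F : I -> T -> R) (x : T) :
  (forall i, {for x, continuous (F i)}) ->
  {for x, continuous (fun y => \sum_(i <- s) F i y)}.
Proof.
move=> cF; elim: s => [|i s ih].
  rewrite (_ : (fun y => _) = fun=> 0); first exact: cst_continuous.
  by apply/funext => y; rewrite big_nil.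
rewrite (_ : (fun y => _) = fun y => F i y + \sum_(j <- s) F j y).
  exact: continuousD.
by apply/funext => y; rewrite big_cons.
Qed.

(** * Local defining functions of a smooth domain *)

Section domain.
Context {R : realType} {n : nat} (Omega : set 'rV[R]_n).
Hypothesis oO : open Omega.
Implicit Types (x y d : 'rV[R]_n) (rho : 'rV[R]_n -> R).

Lemma boundaryP x : boundary Omega x <-> closure Omega x /\ ~ Omega x.
Proof.
rewrite /boundary; split=> -[? nO]; split=> //.
  by move=> Ox; apply: nO; move/interior_id : oO => ->.
by move/interior_id : oO => ->.
Qed.

Lemma closure_domainE x : closure Omega x <-> Omega x \/ boundary Omega x.
Proof.
split=> [cx|[/subset_closure//|/boundaryP[]//]].
have [?|?] := pselect (Omega x); first by left.
by right; apply/boundaryP.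
Qed.

Section defining.
Context x0 (U : set 'rV[R]_n) rho (Urho : defining_function Omega x0 U rho).

Lemma defining_C2at y : U y ->
  C2at rho (fun i => partial i rho) (fun i => partial i (partial i rho)) y.
Proof.
move=> Uy; case: Urho => oU _ /(_ 2)[c0 C1] _ _.
split; first exact: c0.
move=> i; have [d1 [c1 C2]] := C1 i; have [d2 [c2 _]] := C2 i.
split; [exact: c1|exact: c2| |].
  exact: derivableP (d1 _ Uy).
exact: derivableP (d2 _ Uy).
Qed.

Lemma near_defining y : U y -> \forall z \near y, U z.
Proof. by case: Urho => oU *; exact: open_nbhs_nbhs. Qed.

Lemma is_derive_defining y d : U y -> is_derive y d rho (dotv d (grad rho y)).
Proof.
move=> Uy.
have -> : dotv d (grad rho y) = \sum_(i < n) d 0 i * partial i rho y.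
  by apply: eq_bigr => i _; rewrite mxE.
apply: (@is_derive_partials _ _ _ (fun i => partial i rho)) => i.
  by apply: filterS (near_defining Uy) => z /defining_C2at[_ /(_ i)[]].
by have [_ /(_ i)[]] := defining_C2at Uy.
Qed.

Lemma defining_le0 x : closure Omega x -> U x -> rho x <= 0.
Proof.
move=> cx Ux; rewrite leNgt; apply/negP => rx.
have [crho _] := defining_C2at Ux.
have [z [Oz [Uz]]] := cx _ (filterI (near_defining Ux) (cvgr_gt _ crho _ rx)).
by case: Urho => _ _ _ _ /(_ _ Uz)[/(_ Oz)] ? _; rewrite ltNge ltW.
Qed.

Lemma defining_boundary x : boundary Omega x -> U x -> rho x = 0.
Proof.
move=> /boundaryP[cx nOx] Ux; apply/eqP; rewrite eq_le defining_le0//=.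
rewrite leNgt; apply/negP => rx; apply: nOx.
by case: Urho => _ _ _ _ /(_ _ Ux)[_]; apply.
Qed.

(** [rho] vanishes at [x] and decreases along [d], so it is negative just after [x], and inside [U]
    this characterises [Omega]. *)
Lemma defining_inward x d : boundary Omega x -> U x ->
  dotv d (grad rho x) < 0 -> \forall s \near 0^'+, Omega (s *: d + x).
Proof.
move=> bx Ux dx.
have dr : is_derive (0 : R) 1 (fun s : R => - rho (s *: d + x))
    (- dotv d (grad rho x)).
  apply: is_deriveN; apply: is_derive_line; rewrite scale0r add0r.
  exact: is_derive_defining.
have [r r0 rU] := near_line d (near_defining Ux).
have lt0 : 0 < - dotv d (grad rho x) by rewrite oppr_gt0.
have H := derive_right_lt dr lt0.
near=> s.
have s0 : 0 < s by near: s; exact: nbhs_right_gt.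
have Us : U (s *: d + x).
  by apply: rU; rewrite gtr0_norm//; near: s; exact: nbhs_right_lt.
have : - rho (0 *: d + x) < - rho ((s + 0) *: d + x) by near: s.
rewrite addr0 scale0r add0r (defining_boundary bx Ux) oppr0 oppr_gt0.
by case: Urho => _ _ _ _ /(_ _ Us)[_]; apply.
Unshelve. all: by end_near. Qed.

End defining.

(** A direction [d] with [dotv d g1 < 0] enters [Omega], where [rho2 < 0], so [dotv d g2 <= 0]. This
    inclusion of half-spaces forces the gradients to be positively proportional; the second
    inequality is Cauchy-Schwarz reversed, that is, its equality case. *)
Lemma defining_functions_parallel x0 x1 U1 U2 rho1 rho2 x :
  defining_function Omega x0 U1 rho1 -> defining_function Omega x1 U2 rho2 ->
  boundary Omega x -> U1 x -> U2 x ->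
  let g1 := grad rho1 x in let g2 := grad rho2 x in
  0 < dotv g1 g2 /\ dotv g1 g1 * dotv g2 g2 <= dotv g1 g2 ^+ 2.
Proof.
move=> H1 H2 bx U1x U2x g1 g2.
have g10 : 0 < dotv g1 g1 by case: H1 => _ _ _ /(_ _ U1x)/dotv_gt0.
have g20 : 0 < dotv g2 g2 by case: H2 => _ _ _ /(_ _ U2x)/dotv_gt0.
have key d : dotv d g1 < 0 -> dotv d g2 <= 0.
  move=> d1; rewrite leNgt; apply/negP => d2.
  have dr : is_derive (0 : R) 1 (fun s : R => rho2 (s *: d + x)) (dotv d g2).
    apply: is_derive_line; rewrite scale0r add0r.
    exact: is_derive_defining H2 _ _ _.
  have [r r0 rU] := near_line d (near_defining H2 U2x).
  have HO := defining_inward H1 bx U1x d1.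
  have Hr := derive_right_lt dr d2.
  suff : \forall s \near (0 : R)^'+, False by move=> /filter_ex[].
  near=> s.
  have Os : Omega (s *: d + x) by near: s.
  have s0 : 0 < s by near: s; exact: nbhs_right_gt.
  have Us : U2 (s *: d + x).
    by apply: rU; rewrite gtr0_norm//; near: s; exact: nbhs_right_lt.
  have : rho2 (0 *: d + x) < rho2 ((s + 0) *: d + x) by near: s.
  rewrite addr0 scale0r add0r (defining_boundary H2 bx U2x) => rs.
  case: H2 => _ _ _ _ /(_ _ Us)[/(_ Os)] + _.
  by rewrite ltNge ltW.
have c0 : 0 < dotv g1 g2.
  rewrite ltNge; apply/negP => c0.
  (* If [dotv g1 g2 <= 0], the direction [g2 - g1] would enter [Omega] although [rho2] increases
     along it. *)
  have := key (g2 + (-1) *: g1).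
  by rewrite !dotvDl !dotvZl [dotv g2 g1]dotvC => H; have := H _; lra.
split=> //; rewrite leNgt; apply/negP => lt12.
pose A := dotv g1 g1; pose B := dotv g2 g2; pose c := dotv g1 g2.
(* The part of [g2] orthogonal to [g1], tilted by [- e *: g1], has product [- e * A < 0] with [g1].
   This [e] leaves half of [B - c ^+ 2 / A], the squared length of that part, as the product with
   [g2]. *)
pose e := (B - c ^+ 2 / A) / (2 * c).
have e0 : 0 < B - c ^+ 2 / A.
  by rewrite subr_gt0 ltr_pdivrMr// mulrC.
have := key (g2 + (- (c / A) - e) *: g1).
rewrite !dotvDl !dotvZl [dotv g2 g1]dotvC -/A -/B -/c => H.
have : B + (- (c / A) - e) * c <= 0.
  apply: H; rewrite mulrBl mulNr divfK ?gt_eqF// addrA subrr add0r oppr_lt0.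
  by rewrite mulr_gt0// divr_gt0// mulr_gt0.
suff -> : B + (- (c / A) - e) * c = (B - c ^+ 2 / A) / 2.
  by rewrite leNgt divr_gt0.
by rewrite /e; field; rewrite !gt_eqF.
Unshelve. all: by end_near. Qed.

Section barrier.
Context (nu : 'rV[R]_n -> 'rV[R]_n).
Hypothesis hnu : unit_outward_normal Omega nu.
Hypothesis sO : smooth_boundary Omega.

(** [nu x] comes from a defining function that need not be [rho]. As the two gradients are parallel,
    its product with [grad rho x] still reaches the Euclidean length of that gradient. *)
Lemma normal_defining x0 U rho x : defining_function Omega x0 U rho ->
  boundary Omega x -> U x ->
  Num.sqrt (dotv (grad rho x) (grad rho x)) <= dotv (nu x) (grad rho x).
Proof.
move=> H2 bx Ux; have [U1 [rho1 [H1 ->]]] := hnu bx.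
have U1x : U1 x by case: H1.
have [] := defining_functions_parallel H1 H2 bx U1x Ux.
set g1 := grad rho1 x; set g2 := grad rho x => c0 cc.
have g10 : 0 < dotv g1 g1 by case: H1 => _ _ _ /(_ _ U1x)/dotv_gt0.
rewrite dotvZl mulrC ler_pdivlMr ?sqrtr_gt0// -sqrtrM; last first.
  by case: H2 => _ _ _ /(_ _ Ux)/dotv_gt0/ltW.
by rewrite -(ger0_norm (ltW c0)) -sqrtr_sqr ler_wsqrtr// mulrC.
Qed.

(** The sums are the derivative of [rho] along [nu]. Asking for [c] on [A] only, and for a
    nonnegative value on the rest of the boundary, is what lets barriers for different pieces be
    added. *)
Definition boundary_barrier (A : set 'rV[R]_n) rho g h (c : R) :=
  [/\ forall x, C2at rho g h x,
      forall x, closure Omega x -> rho x <= 0,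
      forall x, boundary Omega x -> rho x = 0,
      forall x, boundary Omega x -> 0 <= \sum_(i < n) nu x 0 i * g i x &
      forall x, boundary Omega x -> A x -> c <= \sum_(i < n) nu x 0 i * g i x].

(** The defining function is multiplied by a bump supported inside [U]. On the boundary [rho = 0]
    kills the term that differentiates the bump, so the normal derivative is the bump times that of
    [rho]. *)
Lemma local_barrier y : boundary Omega y -> exists2 A, nbhs y A &
  exists rho g h, exists2 c, 0 < c & boundary_barrier A rho g h c.
Proof.
move=> yb; have [U [rho H]] := sO yb.
have Uy : U y by case: H.
have [r0 /= r00 rU] := (nbhs_ballP _ _).1 (near_defining H Uy).
pose r := r0 / 2; have r_gt0 : 0 < r by rewrite divr_gt0.
have {}rU x : ball y (r * 2) x -> U x by rewrite /r divfK//; exact: rU.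
have [gb [hb Cb]] := C2_cubic_bump r y.
pose sig x := cubic_bump r y x * rho x.
pose gs i x := cubic_bump r y x * partial i rho x + rho x * gb i x.
pose hs i x := cubic_bump r y x * partial i (partial i rho) x + rho x * hb i x
               + 2 * gb i x * partial i rho x.
(* Near a point outside [U] the bump vanishes together with its first and second derivatives, so the
   unknown behaviour of [rho] there is harmless. *)
have near_0 x : ~ U x -> \forall z \near x,
    cubic_bump r y z = 0 /\ forall i, gb i z = 0 /\ hb i z = 0.
  move=> nUx; have b0 : \forall z \near x, cubic_bump r y z = 0.
    by apply: cubic_bump_near0 => // /rU.
  have zero (F : 'rV[R]_n -> R) G i : (\forall z \near x, F z = 0) ->
      (forall z, is_derive z 'e_i F (G z)) -> \forall z \near x, G z = 0.
    move=> F0 FG; have := nbhs_interior F0; apply: filterS => z F0z.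
    have [_ <-] := FG z.
    rewrite (@near_eq_derive _ _ _ F (cst 0)); last exact: F0z.
    exact: derive_cst.
  have gb0 i : \forall z \near x, gb i z = 0.
    by apply: (zero _ _ i b0) => z; have [_ /(_ i)[]] := Cb z.
  have hb0 i : \forall z \near x, hb i z = 0.
    by apply: (zero _ _ i (gb0 i)) => z; have [_ /(_ i)[]] := Cb z.
  near=> z; split; first by near: z.
  by move=> i; split; move: i; near: z; exact: filter_forall.
have dirE x : boundary Omega x -> \sum_(i < n) nu x 0 i * gs i x =
    cubic_bump r y x * dotv (nu x) (grad rho x).
  move=> bx; rewrite /dotv mulr_sumr; apply: eq_bigr => i _; rewrite mxE /gs.
  have [Ux|nUx] := pselect (U x).
    by rewrite (defining_boundary H bx Ux) mul0r addr0 mulrCA.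
  have [-> /(_ i)[-> _]] := nbhs_singleton (near_0 _ nUx).
  by rewrite !mul0r mulr0 addr0 mulr0.
have dir_ge x : boundary Omega x ->
    cubic_bump r y x * Num.sqrt (dotv (grad rho x) (grad rho x)) <=
    \sum_(i < n) nu x 0 i * gs i x.
  move=> bx; rewrite dirE//.
  have [Ux|nUx] := pselect (U x).
    by rewrite ler_wpM2l ?cubic_bump_ge0// (normal_defining H).
  have [-> _] := nbhs_singleton (near_0 _ nUx).
  by rewrite !mul0r.
(* [D] bounds the normal derivative from below without involving [nu]; hence it is continuous at [y]
   and stays above half of [D y] nearby. *)
pose D x := cubic_bump r y x * Num.sqrt (dotv (grad rho x) (grad rho x)).
have D0 : 0 < D y.
  rewrite mulr_gt0 ?cubic_bump_gt0// sqrtr_gt0.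
  by case: H => _ _ _ /(_ _ Uy)/dotv_gt0.
have cD : {for y, continuous D}.
  apply: continuousM; first by case: (Cb y).
  apply: (@continuous_comp _ _ _ (fun x => dotv (grad rho x) (grad rho x)) Num.sqrt).
    apply: continuous_at_sum => i.
    have ci : {for y, continuous (partial i rho)}.
      by have [_ /(_ i)[]] := defining_C2at H Uy.
    rewrite (_ : (fun x => _) = (fun x => partial i rho x * partial i rho x)).
      exact: continuousM.
    by apply/funext => x; rewrite mxE.
  exact: sqrt_continuous.
exists [set x | D y / 2 < D x].
  by apply: cvgr_gt cD _ _; lra.
exists sig, gs, hs; exists (D y / 2); first by rewrite divr_gt0.
split.
- move=> x; have [Ux|nUx] := pselect (U x).
    exact: C2at_mul (Cb x) (defining_C2at H Ux).
  apply: near_C2at (C2at_cst 0 x) => [|i|i]; have := near_0 _ nUx.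
  + by apply: filterS => z [b0 _]; rewrite /sig b0 mul0r.
  + by apply: filterS => z [b0 /(_ i)[g0 _]]; rewrite /gs b0 g0 mul0r mulr0 addr0.
  + apply: filterS => z [b0 /(_ i)[g0 h0]].
    by rewrite /hs b0 g0 h0 mul0r !mulr0 mul0r !addr0.
- move=> x cx; have [Ux|nUx] := pselect (U x).
    by rewrite mulr_ge0_le0 ?cubic_bump_ge0//; exact: defining_le0 H _ cx Ux.
  by rewrite /sig; have [-> _] := nbhs_singleton (near_0 _ nUx); rewrite mul0r.
- move=> x bx; have [Ux|nUx] := pselect (U x).
    by rewrite /sig (defining_boundary H bx Ux) mulr0.
  by rewrite /sig; have [-> _] := nbhs_singleton (near_0 _ nUx); rewrite mul0r.
- move=> x bx; apply: le_trans (dir_ge _ bx).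
  by rewrite mulr_ge0 ?cubic_bump_ge0 ?sqrtr_ge0.
- by move=> x bx /= /ltW DD; exact: le_trans DD (dir_ge _ bx).
Unshelve. all: by end_near. Qed.

End barrier.
End domain.

(** * Global barriers on a bounded domain *)

Section bounded.
Context {R : realType} {n : nat} (Omega : set 'rV[R]_n).
Hypothesis bO : bounded_domain Omega.

Lemma compact_closure_domain : compact (closure Omega).
Proof.
apply: bounded_closed_compact; last exact: closed_closure.
case: bO => _ _ _ [M [Mr MO]]; exists M; split=> // x Mx y cy.
have closed_ball : closed [set z : 'rV[R]_n | `|z| <= x].
  apply: (@closed_comp _ _ (@Num.norm R _) [set r : R | r <= x]) => [z _|].
    exact: norm_continuous.
  exact: closed_le.
by have := closure_subset (MO _ Mx) cy; rewrite -(closure_id _).1.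
Qed.

Lemma compact_boundary_domain : compact (boundary Omega).
Proof.
apply: subclosed_compact compact_closure_domain _ => [|x []//].
by apply: closedI; [exact: closed_closure|exact/open_closedC/open_interior].
Qed.

Context (nu : 'rV[R]_n -> 'rV[R]_n).
Hypothesis hnu : unit_outward_normal Omega nu.
Hypothesis sO : smooth_boundary Omega.

Lemma global_barrier : exists rho g h, exists2 c, 0 < c &
  boundary_barrier Omega nu (boundary Omega) rho g h c.
Proof.
have oO : open Omega by case: bO.
pose P A := exists rho g h, exists2 c, 0 < c & boundary_barrier Omega nu A rho g h c.
apply: (@compact_ind _ P).
- exists (fun=> 0), (fun _ _ => 0), (fun _ _ => 0), 1 => //; split=> //.
    by move=> x; exact: C2at_cst.
  by move=> x _; rewrite big1// => i _; rewrite mulr0.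
- move=> A B [rho [g [h [c c0 [C2 r0 rb g0 gc]]]]].
  move=> [rho' [g' [h' [c' c'0 [C2' r0' rb' g0' gc']]]]].
  exists (fun y => rho y + rho' y), (fun i y => g i y + g' i y),
         (fun i y => h i y + h' i y), (Num.min c c'); first by rewrite lt_min c0.
  have sumE x : \sum_(i < n) nu x 0 i * (g i x + g' i x) =
      \sum_(i < n) nu x 0 i * g i x + \sum_(i < n) nu x 0 i * g' i x.
    by rewrite -big_split; apply: eq_bigr => i _; rewrite mulrDr.
  split=> [x|x cx|x bx|x bx|x bx AB].
  + exact: C2at_add.
  + by rewrite -[leRHS]addr0 lerD ?r0 ?r0'.
  + by rewrite rb// rb'// addr0.
  + by rewrite sumE addr_ge0 ?g0 ?g0'.
  + rewrite sumE ge_min; case: AB => [Ax|Bx]; apply/orP; [left|right].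
      by rewrite -[leLHS]addr0 lerD ?gc ?g0'.
    by rewrite -[leLHS]add0r lerD ?gc' ?g0.
- move=> A B AB [rho [g [h [c c0 [C2 r0 rb g0 gc]]]]].
  by exists rho, g, h, c => //; split=> // x bx /AB; exact: gc.
- exact: compact_boundary_domain.
- by move=> y /(local_barrier oO hnu sO)[A yA PA]; exists A.
Qed.

(** With [phi = 1 + expR (K * rho)], the sign of [rho] gives the bounds 1 and 2 for every [K >= 0],
    while on the boundary, where [rho = 0], the normal derivative is [K] times that of [rho], hence
    at least [K * c], the absolute value of [N]. The price is that [C] depends on [N]; [lam] is
    chosen after it. *)
Lemma steep_barrier (N : R) : exists phi g h,
  [/\ forall x, C2at phi g h x,
      forall x, closure Omega x -> 1 <= phi x <= 2,
      forall x, boundary Omega x -> N <= \sum_(i < n) nu x 0 i * g i x &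
      exists2 C, 0 <= C &
        forall x, closure Omega x -> `|\sum_(i < n) h i x| <= C].
Proof.
have [rho [g [h [c c0 [C2 r0 rb _ gc]]]]] := global_barrier.
pose K := `|N| / c; have K0 : 0 <= K by rewrite divr_ge0// ltW.
pose F (s : R) := 1 + expR (K * s); pose F' (s : R) := K * expR (K * s).
pose F'' (s : R) := K * (K * expR (K * s)).
have dE (s : R) : is_derive s 1 (fun s => expR (K * s)) (K * expR (K * s)).
  have := is_derive1_comp (is_derive_expR (K * s)) (is_deriveZ K (is_derive_id s 1)).
  by rewrite /GRing.scale /= mulr1 mulrC; apply.
have cE : continuous (fun s : R => expR (K * s)).
  by move=> s; apply/differentiable_continuous/derivable1_diffP; case: (dE s).
pose gp i y := F' (rho y) * g i y.
pose hp i y := F'' (rho y) * g i y ^+ 2 + F' (rho y) * h i y.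
have Cp x : C2at (fun y => F (rho y)) gp hp x.
  apply: (@C2at_comp R n F F' F'' _ _ _ _ (C2 x)).
  - near=> y; rewrite -[F' _]add0r.
    by apply: is_deriveD; exact: dE.
  - by apply: continuousM; [exact: cst_continuous|exact: cE].
  - apply: continuousM; first exact: cst_continuous.
    by apply: continuousM; [exact: cst_continuous|exact: cE].
exists (fun y => F (rho y)), gp, hp; split.
- exact: Cp.
- move=> x cx; rewrite /F lerDl expR_ge0/= -lerBrDl (_ : 2 - 1 = 1); last by ring.
  by rewrite -expR0 ler_expR mulr_ge0_le0// r0.
- move=> x bx; rewrite /gp /F' rb// mulr0 expR0 mulr1.
  under eq_bigr do rewrite mulrCA.
  rewrite -mulr_sumr; apply: (le_trans (ler_norm _)).
  by rewrite -[leLHS](divfK (lt0r_neq0 c0)) ler_wpM2l// gc.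
- have cH : {within closure Omega, continuous (fun x => `|\sum_(i < n) hp i x|)}.
    apply: continuous_subspaceT => x.
    apply: (@continuous_comp _ _ _ (fun x => \sum_(i < n) hp i x) (@Num.norm R R)).
      by apply: continuous_at_sum => i; have [_ /(_ i)[]] := Cp x.
    exact: norm_continuous.
  have [x0 Ox0] : Omega !=set0 by case: bO.
  have c0O : closure Omega !=set0 by exists x0; exact: subset_closure.
  have [y _ ym] := compact_EVT_max c0O compact_closure_domain cH.
  by exists `|\sum_(i < n) hp i y| => // x cx; apply: ym; rewrite inE.
Unshelve. all: by end_near. Qed.

End bounded.

(** * Boundary maxima and powers *)

Section boundary_point.
Context {R : realType} {n : nat} (Omega : set 'rV[R]_n).
Hypothesis oO : open Omega.
Context (nu : 'rV[R]_n -> 'rV[R]_n).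
Hypothesis hnu : unit_outward_normal Omega nu.

Lemma within_continuous_for {T U : topologicalType} (A : set T) (f : T -> U) x :
  {within A, continuous f} -> nbhs x A -> {for x, continuous f}.
Proof.
move=> /subspace_continuousP cf Ax.
by have := cf _ (nbhs_singleton Ax); rewrite within_interior.
Qed.

(** [G] is an explicit continuous extension of the gradient, so that differences of functions carry
    differences of the [G]s, and the limit inside [normal_derivative] is evaluated only once per
    solution. *)
Definition C1up (f : 'rV[R]_n -> R) (G : 'rV[R]_n -> 'rV[R]_n) :=
  [/\ {within closure Omega, continuous f},
      {within closure Omega, continuous G} &
      forall x i, Omega x -> is_derive x 'e_i f (G x 0 i)].

Lemma nbhs_closure_domain x : Omega x -> nbhs x (closure Omega).
Proof.
by move=> Ox; apply: filterS (@subset_closure _ Omega) _; exact: open_nbhs_nbhs.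
Qed.

Lemma C1up_directional f G x d : C1up f G -> Omega x ->
  is_derive x d f (dotv d (G x)).
Proof.
move=> [_ cG dG] Ox.
apply: (@is_derive_partials _ _ f (fun i y => G y 0 i)) => i.
  have : nbhs x Omega by exact: open_nbhs_nbhs.
  by apply: filterS => z Oz; exact: dG.
apply: (@continuous_comp _ _ _ G (fun v : 'rV[R]_n => v 0 i)).
  exact: within_continuous_for cG (nbhs_closure_domain Ox).
exact: coord_continuous.
Qed.

Lemma boundary_max_normal f G x : C1up f G -> boundary Omega x ->
  (forall y, closure Omega y -> f y <= f x) -> 0 <= dotv (nu x) (G x).
Proof.
move=> C bx fmax; rewrite leNgt; apply/negP => Gx.
have [cx nOx] := (boundaryP oO x).1 bx.
have [U [rho [H nuE]]] := hnu bx; have Ux : U x by case: H.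
pose d := (-1) *: nu x.
have dx : dotv d (grad rho x) < 0.
  rewrite dotvZl mulN1r oppr_lt0 nuE dotvZl mulr_gt0 ?invr_gt0 ?sqrtr_gt0//;
    by case: H => _ _ _ /(_ _ Ux)/dotv_gt0.
have inw := defining_inward oO H bx Ux dx.
have cd : {within closure Omega, continuous (fun y => dotv d (G y))}.
  case: C => _ cG _.
  apply: (@within_continuous_comp_in _ _ _ _ setT G (fun v => dotv d v)) => //.
  apply: continuous_subspaceT => v; apply: continuous_at_sum => i.
  apply: continuousM; first exact: cst_continuous.
  exact: coord_continuous.
have Gd : 0 < dotv d (G x) by rewrite dotvZl mulN1r oppr_gt0.
have [r r0 rP] := near_line d
  (cvgr_gt _ ((subspace_continuousP _ _).1 cd _ cx) _ Gd).
have [e /= e0 eO] := inw.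
pose m := Num.min e r; have m0 : 0 < m by rewrite lt_min e0.
have me : m <= e by rewrite ge_min lexx.
have mr : m <= r by rewrite ge_min lexx orbT.
pose s := m / 2; have s0 : 0 < s by rewrite divr_gt0.
have lineO t : 0 < t -> t <= s -> Omega (t *: d + x).
  move=> t0 ts; apply: eO => //=.
  by rewrite sub0r normrN gtr0_norm//; rewrite /s in ts; lra.
have lineG t : 0 < t -> t <= s -> 0 < dotv d (G (t *: d + x)).
  move=> t0 ts; apply: rP; last exact/subset_closure/lineO.
  by rewrite gtr0_norm//; rewrite /s in ts; lra.
have dF (t : R) : t \in `]0, s[%R ->
    is_derive t 1 (fun t : R => f (t *: d + x)) (dotv d (G (t *: d + x))).
  rewrite in_itv /= => /andP[t0 ts]; apply: is_derive_line.
  by apply: C1up_directional => //; apply: lineO => //; exact: ltW.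
have cF : {within `[0, s], continuous (fun t : R => f (t *: d + x))}.
  case: C => cf _ _; apply: (within_continuous_comp_in _ _ cf).
    move=> t; rewrite /= in_itv /= => /andP[t0 ts].
    have [->|t1] := eqVneq t 0; first by rewrite scale0r add0r.
    by apply/subset_closure/lineO => //; rewrite lt_neqAle eq_sym t1.
  apply: continuous_subspaceT => t.
  by apply: cvgD; [apply: cvgZ; [exact: cvg_id|exact: cvg_cst]|exact: cvg_cst].
have [xi] := MVT s0 dF cF.
rewrite in_itv /= => /andP[xi0 xis] E.
have : f (s *: d + x) <= f (0 *: d + x).
  rewrite [in leRHS]scale0r add0r; apply: fmax.
  exact/subset_closure/lineO.
by rewrite -subr_le0 E subr0 leNgt mulr_gt0//; apply: lineG => //; exact: ltW.
Qed.

Lemma normal_derivativeE f G x : {within closure Omega, continuous G} ->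
  (forall y, Omega y -> G y = grad f y) -> closure Omega x ->
  normal_derivative Omega nu f x = dotv (nu x) (G x).
Proof.
move=> cG GE cx; rewrite /normal_derivative dotvC; congr (dotv _ _).
have PF : ProperFilter (within Omega (nbhs x)) by exact: within_nbhs_proper.
apply: cvg_lim => //.
have H : G y @[y --> within Omega (nbhs x)] --> G x.
  have L : within Omega (nbhs x) --> within (closure Omega) (nbhs x).
    move=> W cW; have : nbhs x (fun y => closure Omega y -> W y) := cW.
    by apply: filterS => y HW Oy; apply/HW/subset_closure.
  exact: cvg_trans (cvg_fmap2 L) ((subspace_continuousP _ _).1 cG _ cx).
apply: cvg_trans H; apply: near_eq_cvg.
by near=> y; apply/GE; near: y; exact: withinT.
Unshelve. all: by end_near. Qed.

End boundary_point.

(** * Lipschitz bounds for real powers *)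

Section powers.
Context {R : realType}.

Lemma powR_mean_value (r x y : R) : 0 < x -> x <= y ->
  exists2 z, x <= z <= y & y `^ r - x `^ r = r * z `^ (r - 1) * (y - x).
Proof.
move=> x0 xy.
have d (z : R) : z \in `]x, y[%R ->
    is_derive z 1 (fun t : R => t `^ r) (r * z `^ (r - 1)).
  rewrite in_itv /= => /andP[xz _]; apply: is_derive1_powR.
  exact: lt_trans xz.
have c : {within `[x, y], continuous (fun t : R => t `^ r)}.
  apply: derivable_within_continuous => z; rewrite in_itv /= => /andP[xz _].
  by apply: derivable_powR; rewrite in_itv /= andbT (lt_le_trans x0).
have [z] := MVT_segment xy d c.
by rewrite in_itv /= => zxy E; exists z.
Qed.

Lemma powR_lipschitz_ge1 (r M : R) : 1 <= r -> exists2 L, 0 <= L &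
  forall x y, 0 <= x <= M -> 0 <= y <= M -> `|x `^ r - y `^ r| <= L * `|x - y|.
Proof.
move=> r1; exists (r * M `^ (r - 1)).
  by rewrite mulr_ge0 ?powR_ge0// (le_trans ler01).
suff H x y : 0 <= x -> x <= y -> y <= M ->
    `|x `^ r - y `^ r| <= r * M `^ (r - 1) * `|x - y|.
  move=> x y /andP[x0 xM] /andP[y0 yM]; have [xy|yx] := leP x y; first exact: H.
  by rewrite distrC [`|x - y|]distrC H// ltW.
move=> x0 xy yM; rewrite distrC [`|x - y|]distrC.
have r0 : 0 <= r by rewrite (le_trans ler01).
have xyr : x `^ r <= y `^ r.
  by rewrite ge0_ler_powR// nnegrE// (le_trans x0).
have mono z : 0 <= z -> z <= M -> z `^ (r - 1) <= M `^ (r - 1).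
  by move=> z0 zM; rewrite ge0_ler_powR ?subr_ge0 ?nnegrE// (le_trans z0).
rewrite !ger0_norm ?subr_ge0//.
(* The mean value theorem needs a positive left endpoint. From 0, the r-th power of [y] is bounded
   directly, as [y] times its power of exponent [r - 1]. *)
have [x00|x00] := eqVneq x 0.
  rewrite x00 powR0 ?subr0 ?gt_eqF ?(lt_le_trans ltr01)//.
  rewrite -mulr_powRB1 ?(le_trans x0)// ?(lt_le_trans ltr01)//.
  rewrite mulrC ler_wpM2r ?(le_trans x0)//.
  apply: (le_trans (mono _ (le_trans x0 xy) yM)).
  by rewrite ler_peMl// powR_ge0.
have xp : 0 < x by rewrite lt_neqAle eq_sym x00.
have [z /andP[xz zy] ->] := powR_mean_value r xp xy.
rewrite ler_wpM2r ?subr_ge0// ler_wpM2l// mono//; first exact: le_trans xz.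
exact: le_trans yM.
Qed.

(** If [y >= c / 2], the derivative of the power is bounded between [c / 2] and [M]. If [y < c / 2],
    then [x - y >= c / 2], and the difference of powers, at most the r-th power of [M], is a bounded
    multiple of this gap. *)
Lemma powR_lipschitz_pos (r c M : R) : 0 <= r -> 0 < c -> exists2 L, 0 <= L &
  forall x y, c <= x <= M -> 0 <= y <= M -> `|x `^ r - y `^ r| <= L * `|x - y|.
Proof.
move=> r0 c0; pose c2 := c / 2.
have c20 : 0 < c2 by rewrite divr_gt0.
(* Between [c2] and [M] the power of exponent [r - 1] is largest at [M] if [r >= 1] and at [c2] if
   [r < 1]; the sum covers both. *)
pose K := r * (c2 `^ (r - 1) + M `^ (r - 1)).
have K0 : 0 <= K by rewrite mulr_ge0// addr_ge0 ?powR_ge0.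
have mono z : c2 <= z -> z <= M -> z `^ (r - 1) <= c2 `^ (r - 1) + M `^ (r - 1).
  move=> cz zM; have z0 := lt_le_trans c20 cz.
  have [r1|r1] := leP 1 r.
    rewrite -[leLHS]add0r lerD ?powR_ge0//.
    by rewrite ge0_ler_powR ?subr_ge0 ?nnegrE ?(ltW z0)// (le_trans (ltW z0)).
  rewrite -[leLHS]addr0 lerD ?powR_ge0//.
  rewrite -opprB !powRN lef_pV2 ?posrE ?powR_gt0//.
  by rewrite ge0_ler_powR ?subr_ge0 ?nnegrE ?(ltW c20) ?(ltW z0) ?(ltW r1).
have H x y : c2 <= x -> x <= y -> y <= M ->
    `|x `^ r - y `^ r| <= K * `|x - y|.
  move=> cx xy yM; have x0 := lt_le_trans c20 cx.
  rewrite distrC [`|x - y|]distrC.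
  have [z /andP[xz zy] ->] := powR_mean_value r x0 xy.
  rewrite normrM ler_wpM2r// ger0_norm; last by rewrite mulr_ge0 ?powR_ge0.
  by rewrite ler_wpM2l// mono ?(le_trans cx)// (le_trans zy).
exists (K + M `^ r / c2).
  by rewrite addr_ge0// divr_ge0 ?powR_ge0 ?ltW.
move=> x y /andP[cx xM] /andP[y0 yM].
have [cy|yc] := leP c2 y.
  apply: (@le_trans _ _ (K * `|x - y|)).
    have c2x : c2 <= x by rewrite /c2; lra.
    have [xy|/ltW yx] := leP x y; first exact: H.
    by rewrite distrC [`|x - y|]distrC H.
  by rewrite ler_wpM2r// lerDl divr_ge0 ?powR_ge0 ?ltW.
have yx : y <= x by rewrite /c2 in yc; lra.
have yxr : y `^ r <= x `^ r by rewrite ge0_ler_powR ?nnegrE// (le_trans y0).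
have xy2 : c2 <= x - y by rewrite /c2 in yc *; lra.
rewrite !ger0_norm ?subr_ge0//.
apply: (@le_trans _ _ (M `^ r / c2 * (x - y))); last first.
  by rewrite ler_wpM2r ?subr_ge0// lerDr.
apply: (@le_trans _ _ (M `^ r)).
  rewrite lerBlDr -[leLHS]addr0 lerD ?powR_ge0//.
  by rewrite ge0_ler_powR ?nnegrE// (le_trans y0)// (le_trans yx).
by rewrite mulrAC ler_pdivlMr// ler_wpM2l ?powR_ge0.
Qed.

End powers.

(** * Integrals *)

Section integrals.
Context {R : realType}.

Section finite_measure.
Context {d : measure_display} {T : measurableType d}.
Context (mu : {measure set T -> \bar R}) (D : set T).
Hypotheses (mD : measurable D) (fD : (mu D < +oo)%E).
Implicit Types f g : T -> R.

Lemma bounded_integrable f M : measurable_fun D f ->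
  (forall x, D x -> `|f x| <= M) -> mu.-integrable D (EFin \o f).
Proof.
move=> mf fM; apply: measurable_bounded_integrable => //.
by exists M; split=> [|r Mr x Dx /=]; rewrite ?num_real// (le_trans (fM _ Dx))// ltW.
Qed.

Lemma le_dist_Rintegral f g M B : measurable_fun D f -> measurable_fun D g ->
  (forall x, D x -> `|f x| <= M) -> (forall x, D x -> `|g x| <= M) ->
  (forall x, D x -> `|f x - g x| <= B) ->
  `|\int[mu]_(x in D) f x - \int[mu]_(x in D) g x| <= B * fine (mu D).
Proof.
move=> mf mg fM gM fg.
have intf := bounded_integrable mf fM; have intg := bounded_integrable mg gM.
rewrite -RintegralB//.
have mfg : measurable_fun D (fun x => f x - g x) by exact: measurable_realfun.measurable_funB.
apply: le_trans (le_normr_Rintegral mD (bounded_integrable mfg fg)) _.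
rewrite -Rintegral_cst//; apply: le_Rintegral => //.
  apply: (@bounded_integrable _ B); first exact: measurableT_comp.
  by move=> x Dx; rewrite normr_id fg.
apply: (@bounded_integrable _ `|B|) => //; exact: measurable_cst.
Qed.

End finite_measure.

Section space.
Context {n : nat} (Omega : set 'rV[R]_n).

Lemma open_measurable_rV : open Omega -> measurable (Omega : set (rVBorel R n)).
Proof. exact: sub_sigma_algebra. Qed.

Lemma bounded_finite_rV : open Omega -> bounded_set Omega ->
  (lebesgue_rV n (Omega : set (rVBorel R n)) < +oo)%E.
Proof.
move=> oO [M [Mr MO]].
pose box := [set v : 'rV[R]_n | forall i, `[- (M + 1), M + 1]%classic (v 0 i)].
have mbox : measurable (box : set (rVBorel R n)).
  rewrite (_ : box = \bigcap_(i in [set: 'I_n])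
      ((fun v : rVBorel R n => (v : 'rV[R]_n) 0 i) @^-1` `[- (M + 1), M + 1]%classic)).
    apply: fin_bigcap_measurable => // i _.
    rewrite -[X in measurable X]setTI.
    by apply: continuous_measurable_rV => //; exact: coord_continuous.
  by apply/seteqP; split => [v vA i _|v vA i]; exact: vA.
apply: (@le_lt_trans _ _ (lebesgue_rV n (box : set (rVBorel R n)))).
  apply: le_measure; rewrite ?inE//; first exact: open_measurable_rV.
  move=> v Ov i; rewrite /= in_itv /= -ler_norml.
  have M1 : M < M + 1 by rewrite ltrDl.
  apply: le_trans (MO _ M1 v Ov).
  have /mapP[j _ ->] : `|v 0 i| \in [seq `|v x.1 x.2| | x : 'I_1 * 'I_n].
    by apply/mapP; exists (ord0, i) => //=; rewrite mem_enum.
  by rewrite [leRHS]/Num.Def.normr /= mx_normrE; apply/bigmax_geP; right => /=; exists j.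
rewrite (@lebesgue_rV_box R n (fun=> `[- (M + 1), M + 1]%classic)); last first.
  by move=> i; exact: measurable_itv.
rewrite ltey_eq; apply/orP; left.
elim/big_ind : _ => // [x y|i _]; first exact: fin_numM.
by rewrite lebesgue_measure_itv /=; case: ifPn.
Qed.

Lemma open_continuous_measurable_rV (f : 'rV[R]_n -> R) : open Omega ->
  {within Omega, continuous f} ->
  measurable_fun (Omega : set (rVBorel R n)) (f : rVBorel R n -> R).
Proof.
move=> oO /continuousP cf mO.
apply: (measurability _ (measurable_realfun.RGenOpens.measurableE R)) => //.
move=> _ [_ [a [b ->]] <-]; apply: sub_sigma_algebra.
rewrite /= (@open_setSI 'rV[R]_n)//; apply: cf; exact: interval_open.
Qed.

End space.
End integrals.

(** * Solutions *)

Lemma continuous_row {R : realType} {n : nat} {V : topologicalType}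
    (g : 'I_n -> V -> R) (y : V) : (forall i, {for y, continuous (g i)}) ->
  {for y, continuous (fun z => \row_i g i z : 'rV[R]_n)}.
Proof.
move=> cg; apply/cvg_ballP => e e0.
have H i : \forall z \near y, ball (g i y) e (g i z).
  by have /cvg_ballP := cg i; apply.
have {}H : \forall z \near y, forall i, ball (g i y) e (g i z).
  exact: filter_forall.
apply: filterS H => z gz.
by split => // i j; rewrite !mxE; exact: gz.
Qed.

Lemma continuous_pair_left {U V : topologicalType} (y : V) :
  continuous (fun x : U => (x, y)).
Proof. by move=> x; apply: cvg_pair; [exact: cvg_id|exact: cvg_cst]. Qed.

Lemma continuous_pair_right {U V : topologicalType} (x : U) :
  continuous (fun y : V => (x, y)).
Proof. by move=> y; apply: cvg_pair; [exact: cvg_cst|exact: cvg_id]. Qed.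

(** * Contact of a difference with a barrier *)

Section touching.
Context {R : realType} {n : nat} (Omega : set 'rV[R]_n).
Implicit Types (f : 'rV[R]_n -> R).

Definition twice_partial f x := forall i,
  (\forall y \near x, is_derive y 'e_i f (partial i f y)) /\
  is_derive x 'e_i (partial i f) (partial i (partial i f) x).

Lemma partial_cst (c : R) (i : 'I_n) :
  partial i (fun=> c) = (fun=> 0) :> ('rV[R]_n -> R).
Proof. by apply/funext => x; rewrite /partial derive_cst. Qed.

Lemma twice_partial_cst c x : twice_partial (fun=> c) x.
Proof.
move=> i; rewrite !partial_cst; split; last exact: is_derive_cst.
by near=> y; exact: is_derive_cst.
Unshelve. all: by end_near. Qed.

Lemma laplacian_cst (c : R) (x : 'rV[R]_n) : laplacian (fun=> c) x = 0.
Proof. by rewrite /laplacian big1// => i _; rewrite !partial_cst. Qed.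

(** The second-derivative test in each coordinate direction, summed; mixed derivatives never enter.
    The pair [f], [f'] is two solutions for uniqueness, and the constant 0 with a solution for
    positivity. *)
Lemma laplacian_max f f' phi g h (c : R) x :
  twice_partial f x -> twice_partial f' x -> (forall y, C2at phi g h y) ->
  (\forall y \near x, f y - f' y - c * phi y <= f x - f' x - c * phi x) ->
  laplacian f x - laplacian f' x <= c * \sum_(i < n) h i x.
Proof.
move=> df df' C fmax; rewrite -subr_le0 /laplacian mulr_sumr -!sumrB.
apply: sumr_le0 => i _.
have [df1 df2] := df i; have [df1' df2'] := df' i.
have [_ /(_ i)[_ _ _ dg]] := C x.
have [] // := @derive2_max R _ (fun y => f y - f' y - c * phi y)
  (fun y => partial i f y - partial i f' y - c * g i y) x 'e_i
  (partial i (partial i f) x - partial i (partial i f') x - c * h i x) _ _ fmax.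
  near=> y; have [_ /(_ i)[_ _ dphi _]] := C y.
  apply: is_deriveB; last exact: is_deriveZ.
  by apply: is_deriveB; near: y.
Unshelve. all: by end_near. Qed.

Lemma C1up_sub f G f' G' phi g h (c : R) : C1up Omega f G -> C1up Omega f' G' ->
  (forall y, C2at phi g h y) ->
  C1up Omega (fun y => f y - f' y - c * phi y)
    (fun y => G y - G' y - c *: \row_i g i y).
Proof.
move=> [cf cG dG] [cf' cG' dG'] C; split.
- move=> x; apply: cvgB.
    by apply: cvgB; [exact: cf|exact: cf'].
  have cp : {within closure Omega, continuous (fun y => c * phi y)}.
    apply: continuous_subspaceT => y; apply: continuousM; first exact: cst_continuous.
    by case: (C y).
  exact: cp.
- move=> x; apply: cvgB; first by apply: cvgB; [exact: cG|exact: cG'].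
  have cg : continuous (fun y => c *: \row_i g i y : 'rV[R]_n).
    move=> y.
    have row_cvg : {for y, continuous (fun z => \row_i g i z : 'rV[R]_n)}.
      by apply: continuous_row => i; have [_ /(_ i)[]] := C y.
    by apply: (continuous_comp row_cvg); exact: scaler_continuous.
  have : {within closure Omega, continuous (fun y => c *: \row_i g i y : 'rV[R]_n)}.
    exact: continuous_subspaceT.
  exact.
- move=> x i Ox; rewrite !mxE.
  have [_ /(_ i)[_ _ dphi _]] := C x.
  exact: (is_deriveB (is_deriveB (dG x i Ox) (dG' x i Ox)) (is_deriveZ c dphi)).
Qed.

End touching.

(** * Regularity and bounds for one solution *)

Section solution.
Context {R : realType} {n : nat} (Omega : set 'rV[R]_n).
Hypothesis bO : bounded_domain Omega.
Context (nu : 'rV[R]_n -> 'rV[R]_n).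
Context (p q m l a b : R) (k : 'rV[R]_n -> 'rV[R]_n -> R -> R)
  (u0 : 'rV[R]_n -> R) (T : R).
Implicit Types (u v : 'rV[R]_n -> R -> R).
Notation sol := (is_solution Omega nu p q m l a b k u0 T).

Lemma domain_open : open Omega. Proof. by case: bO. Qed.
Local Notation oO := domain_open.

Lemma QGammaE x t : 0 < T -> (QT Omega T `|` GammaT Omega T) (x, t) <->
  closure Omega x /\ 0 <= t < T.
Proof.
move=> T0; rewrite /QT /GammaT /ST /= !in_itv /=; split.
  case=> [[Ox /andP[t0 tT]]|[[[cx _] /andP[t0 tT]]|[cx tE]]].
  - by split; [exact: subset_closure|rewrite ltW].
  - by split=> //; rewrite ltW.
  - by split=> //; rewrite tE lexx.
move=> [cx /andP[]]; rewrite le_eqVlt => /predU1P[<- _|t0 tT].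
  by right; right.
have [Ox|bx] := (closure_domainE oO x).1 cx; first by left; rewrite t0.
by right; left; rewrite t0.
Qed.

Definition cylinder (t0 t1 : R) : set ('rV[R]_n * R) :=
  closure Omega `*` `[t0, t1]%classic.

Lemma compact_cylinder t0 t1 : compact (cylinder t0 t1).
Proof.
by apply: compact_setX; [exact: compact_closure_domain|exact: segment_compact].
Qed.

Lemma cylinder_sub t0 t1 : 0 <= t0 -> t1 < T ->
  cylinder t0 t1 `<=` QT Omega T `|` GammaT Omega T.
Proof.
move=> t00 t1T [x t] [/= cx]; rewrite in_itv /= => /andP[t0t tt1].
have t0' : 0 <= t by exact: le_trans t0t.
have tT : t < T by exact: le_lt_trans t1T.
by apply/QGammaE; rewrite ?t0' ?(le_lt_trans t0' tT).
Qed.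

Section facts.
Context (u : 'rV[R]_n -> R -> R) (su : sol u) (T0 : 0 < T).

Lemma sol_ge0 x t : closure Omega x -> 0 <= t < T -> 0 <= u x t.
Proof. by move=> cx tT; case: su => u0' _ _ _ _; apply/u0'/QGammaE. Qed.

Lemma sol_continuous t0 t1 : 0 <= t0 -> t1 < T ->
  {within cylinder t0 t1, continuous (fun z => u z.1 z.2)}.
Proof.
move=> t00 t1T; case: su => _ [_ [cu _ _]] _ _ _.
exact: continuous_subspaceW (cylinder_sub t00 t1T) cu.
Qed.

Lemma sol_bounded t1 : t1 < T -> exists2 M, 0 <= M &
  forall x t, closure Omega x -> 0 <= t <= t1 -> 0 <= u x t <= M.
Proof.
move=> t1T.
have cb := continuous_compact (sol_continuous (lexx 0) t1T) (@compact_cylinder 0 t1).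
have [M M0 uM] := ex_strict_bound_gt0 (compact_bounded cb).
exists M; first exact: ltW.
move=> x t cx /andP[t0 tt1].
rewrite sol_ge0 ?t0 ?(le_lt_trans tt1)//=; apply: le_trans (ler_norm _) _.
apply/ltW/(uM (u x t)); exists (x, t) => //; split=> //=.
by rewrite in_itv /= t0.
Qed.

(** The gradient extends continuously at every time, including 0, whereas the flux condition of a
    solution is imposed on [ST] only, hence the premise [0 < t]. *)
Lemma sol_C1up t : 0 <= t < T -> exists2 G, C1up Omega (u^~ t) G &
  0 < t -> forall x, boundary Omega x ->
    dotv (nu x) (G x) = nonlocal_flux Omega l k t (u^~ t) x.
Proof.
move=> /andP[t0 tT]; case: su => _ [_ [cu du [G [cG GE]]]] _ bu _.
have tTb : 0 <= t < T by rewrite t0.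
have ct : {within closure Omega, continuous (fun x : 'rV[R]_n => (x, t))}.
  exact/continuous_subspaceT/continuous_pair_left.
have cQ x : closure Omega x -> (QT Omega T `|` GammaT Omega T) (x, t).
  by move=> cx; apply/QGammaE.
have cGt : {within closure Omega, continuous (fun x => G (x, t))}.
  exact: (within_continuous_comp_in cQ ct cG).
exists (fun x => G (x, t)).
  split=> //; first exact: (within_continuous_comp_in cQ ct cu).
  move=> x i Ox; rewrite GE// mxE; apply: derivableP; exact: du.
move=> t0' x bx; rewrite -bu; last by split=> //=; rewrite in_itv /= t0'.
rewrite (normal_derivativeE nu cGt)//; last by case: bx.
by move=> y Oy; rewrite GE.
Qed.

Lemma sol_twice_partial x t : Omega x -> 0 < t < T -> twice_partial (u^~ t) x.
Proof.
move=> Ox tT i; case: su => _ [[_ _ d1 d2] _] _ _ _.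
have [d1i _] := d1 i; have [d2i _] := d2 i i.
have QTt y : Omega y -> QT Omega T (y, t) by split=> //=; rewrite in_itv.
split; last by apply: derivableP; apply: d2i; exact: QTt.
have : nbhs x Omega by apply: open_nbhs_nbhs; split=> //; exact: oO.
by apply: filterS => y Oy; apply: derivableP; apply: d1i; exact: QTt.
Qed.

Lemma sol_is_derive_time x t : Omega x -> 0 < t < T ->
  is_derive t 1 (u x) (laplacian (u^~ t) x
    + a * u x t `^ p * (\int[lebesgue_measure]_(s in `[0, t]) (u x s `^ q))
    - b * u x t `^ m).
Proof.
move=> Ox tT; case: su => _ [[_ [d1 _] _ _] _] pde _ _.
have Qx : QT Omega T (x, t) by split=> //=; rewrite in_itv.
rewrite -pde//; exact: derivableP (d1 _ _ Qx).
Qed.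

Lemma sol_time_measurable x t r : closure Omega x -> 0 <= t < T ->
  measurable_fun `[0, t] (fun s => u x s `^ r).
Proof.
move=> cx /andP[t0 tT].
apply: (measurableT_comp (measurable_realfun.measurable_powR r)).
apply: measurable_realfun.subspace_continuous_measurable_fun => //.
have cs : {within `[0, t], continuous (fun s : R => (x, s))}.
  exact/continuous_subspaceT/continuous_pair_right.
apply: (within_continuous_comp_in _ cs (sol_continuous (lexx 0) tT)).
by move=> s; split.
Qed.

Lemma sol_space_measurable t r : 0 <= t < T ->
  measurable_fun (Omega : set (rVBorel R n)) (fun x : rVBorel R n => u x t `^ r).
Proof.
move=> tT; have [G [cu _ _] _] := sol_C1up tT.
apply: (measurableT_comp (measurable_realfun.measurable_powR r)).
apply: open_continuous_measurable_rV; first exact: oO.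
exact: continuous_subspaceW (@subset_closure _ Omega) cu.
Qed.

(** The initial condition is imposed inside [Omega]. Both sides are continuous on the closure, so it
    passes to boundary points by uniqueness of limits. *)
Lemma sol_initial (c0 : {within closure Omega, continuous u0}) x :
  closure Omega x -> u x 0 = u0 x.
Proof.
move=> cx; have T00 : 0 <= (0 : R) < T by rewrite lexx T0.
have [G [cu _ _] _] := sol_C1up T00.
case: su => _ _ _ _ ui.
have PF : ProperFilter (within Omega (nbhs x)) by exact: within_nbhs_proper.
have L : within Omega (nbhs x) --> within (closure Omega) (nbhs x).
  move=> W cW; have : nbhs x (fun y => closure Omega y -> W y) := cW.
  by apply: filterS => y HW Oy; apply/HW/subset_closure.
have H1 : u y 0 @[y --> within Omega (nbhs x)] --> u x 0.
  exact: cvg_trans (cvg_fmap2 L) ((subspace_continuousP _ _).1 cu _ cx).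
have H2 : u0 y @[y --> within Omega (nbhs x)] --> u0 x.
  exact: cvg_trans (cvg_fmap2 L) ((subspace_continuousP _ _).1 c0 _ cx).
rewrite -(cvg_lim _ H1)// -(cvg_lim _ H2)//; congr (lim _).
rewrite eqEsubset; split; apply: near_eq_cvg; near=> y.
  by rewrite ui//; near: y; exact: withinT.
by rewrite ui//; near: y; exact: withinT.
Unshelve. all: by end_near. Qed.

End facts.
End solution.

(** * Comparison *)

Section comparison.
Context {R : realType} {n : nat} (Omega : set 'rV[R]_n).
Hypothesis bO : bounded_domain Omega.
Hypothesis sO : smooth_boundary Omega.
Context (nu : 'rV[R]_n -> 'rV[R]_n).
Hypothesis hnu : unit_outward_normal Omega nu.
Context (p q m l a b : R) (k : 'rV[R]_n -> 'rV[R]_n -> R -> R)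
  (u0 : 'rV[R]_n -> R) (T : R).
Hypotheses (p0 : 0 <= p) (q0 : 0 < q) (m0 : 0 < m) (l0 : 0 < l)
  (a0 : 0 < a) (b0 : 0 < b) (T0 : 0 < T).
Hypothesis hk : {within (boundary Omega `*` closure Omega) `*` `[0, +oo[,
             continuous (fun z => k z.1.1 z.1.2 z.2)}.
Hypothesis hk0 : forall x y t, boundary Omega x -> closure Omega y -> 0 <= t ->
  0 <= k x y t.
Hypothesis c0 : {within closure Omega, continuous u0}.
Implicit Types (u v : 'rV[R]_n -> R -> R).
Notation sol := (is_solution Omega nu p q m l a b k u0 T).
Let oO : open Omega := domain_open bO.
Notation vol := (fine (lebesgue_rV n (Omega : set (rVBorel R n)))).

Lemma kernel_bounded t1 : exists2 K, 0 <= K & forall x y t,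
  boundary Omega x -> closure Omega y -> 0 <= t <= t1 -> `|k x y t| <= K.
Proof.
pose D := (boundary Omega `*` closure Omega) `*` `[0, t1]%classic.
have cD : compact D.
  apply: compact_setX; last exact: segment_compact.
  by apply: compact_setX; [exact: compact_boundary_domain|exact: compact_closure_domain].
have DS : D `<=` (boundary Omega `*` closure Omega) `*` `[0, +oo[.
  by move=> z [? /=]; rewrite !in_itv /= andbT => /andP[].
have cb := continuous_compact (continuous_subspaceW DS hk) cD.
have [K K0 kK] := ex_strict_bound_gt0 (compact_bounded cb).
exists K; first exact: ltW.
move=> x y t bx cy t01; apply/ltW/(kK (k x y t)).
by exists (x, y, t).
Qed.

Lemma kernel_measurable x t : boundary Omega x -> 0 <= t ->
  measurable_fun (Omega : set (rVBorel R n)) (fun y : rVBorel R n => k x y t).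
Proof.
move=> bx t0; apply: open_continuous_measurable_rV => //.
have c : {within Omega, continuous (fun y : 'rV[R]_n => ((x, y), t))}.
  apply: continuous_subspaceT => y.
  apply: (@continuous_comp _ _ _ (fun y : 'rV[R]_n => (x, y)) (fun z => (z, t))).
    exact: continuous_pair_right.
  exact: continuous_pair_left.
apply: (within_continuous_comp_in _ c hk) => y Oy; split=> /=.
  by split=> //=; exact: subset_closure.
by rewrite in_itv /= t0.
Qed.

Lemma flux_dist K M B u v x t : sol u -> sol v -> boundary Omega x -> 0 <= t < T ->
  (forall y, Omega y -> `|k x y t| <= K) ->
  (forall y, Omega y -> 0 <= u y t <= M) -> (forall y, Omega y -> 0 <= v y t <= M) ->
  (forall y, Omega y -> `|u y t `^ l - v y t `^ l| <= B) ->
  `|nonlocal_flux Omega l k t (u^~ t) x - nonlocal_flux Omega l k t (v^~ t) x|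
    <= K * B * vol.
Proof.
move=> su sv bx tT kK uM vM uvB.
have t0 : 0 <= t by case/andP: tT.
have mk := kernel_measurable bx t0.
have mu w : sol w -> measurable_fun (Omega : set (rVBorel R n))
    (fun y : rVBorel R n => k x y t * w y t `^ l).
  by move=> sw; apply: measurable_realfun.measurable_funM => //;
    exact: sol_space_measurable sw T0 _ _ tT.
have bd w : (forall y, Omega y -> 0 <= w y t <= M) -> forall y, Omega y ->
    `|k x y t * w y t `^ l| <= K * M `^ l.
  move=> wM y Oy; rewrite normrM ler_pM// ?kK//.
  have /andP[w0 wm] := wM _ Oy.
  by rewrite ger0_norm ?powR_ge0// ge0_ler_powR ?nnegrE ?(ltW l0)// (le_trans w0).
apply: (le_dist_Rintegral _ _ (mu _ su) (mu _ sv) (bd _ uM) (bd _ vM)).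
- exact: open_measurable_rV.
- by apply: bounded_finite_rV => //; case: bO.
- by move=> y Oy; rewrite -mulrBr normrM ler_pM// ?kK// uvB.
Qed.

Lemma flux_ge0 u x t : boundary Omega x -> 0 <= t ->
  0 <= nonlocal_flux Omega l k t (u^~ t) x.
Proof.
move=> bx t0; apply: Rintegral_ge0 => y Oy; rewrite mulr_ge0 ?powR_ge0//.
by apply: hk0 => //; exact: subset_closure.
Qed.

Notation memory u x t := (\int[lebesgue_measure]_(s in `[0, t]) (u x s `^ q)).

Lemma lebesgue_measure_itv0 (t : R) : 0 <= t ->
  lebesgue_measure (`[0, t]%classic : set R) = t%:E.
Proof.
move=> t0; rewrite lebesgue_measure_itv /= lte_fin; case: ltP => [_|t0'].
  by rewrite -EFinD oppr0 addr0.
by congr EFin; apply/eqP; rewrite eq_le t0 t0'.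
Qed.

Lemma segment_finite (t : R) : 0 <= t ->
  (lebesgue_measure (`[0%R, t]%classic : set R) < +oo)%E.
Proof. by move=> t0; rewrite lebesgue_measure_itv0// ltry. Qed.

Lemma powR_bounded M w (t r : R) : 0 <= r ->
  (forall s, 0 <= s <= t -> 0 <= w s <= M) ->
  forall s, `[0, t]%classic s -> `|w s `^ r| <= M `^ r.
Proof.
move=> r0 wM s; rewrite /= in_itv /= => st; have /andP[w0 wm] := wM _ st.
by rewrite ger0_norm ?powR_ge0// ge0_ler_powR ?nnegrE// (le_trans w0).
Qed.

Lemma memory_dist M B u v x t : sol u -> sol v -> closure Omega x -> 0 <= t < T ->
  (forall s, 0 <= s <= t -> 0 <= u x s <= M) ->
  (forall s, 0 <= s <= t -> 0 <= v x s <= M) ->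
  (forall s, 0 <= s <= t -> `|u x s `^ q - v x s `^ q| <= B) ->
  `|memory u x t - memory v x t| <= B * t.
Proof.
move=> su sv cx tT uM vM uvB.
have t0 : 0 <= t by case/andP: tT.
have lt := lebesgue_measure_itv0 t0.
rewrite [X in _ <= B * X](_ : t =
  fine (lebesgue_measure (`[0, t]%classic : set R))); last by rewrite lt.
apply: (@le_dist_Rintegral R _ (measurableTypeR R) lebesgue_measure
  (`[0, t]%classic : set R) _ (segment_finite t0)
  (fun s => u x s `^ q) (fun s => v x s `^ q) (M `^ q) B _ _
  (powR_bounded (ltW q0) uM) (powR_bounded (ltW q0) vM)).
- exact: measurable_itv.
- by apply: (sol_time_measurable bO su).
- by apply: (sol_time_measurable bO sv).
- by move=> s; rewrite /= in_itv /=; exact: uvB.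
Qed.

Lemma memory_integrable M u x t : sol u -> closure Omega x -> 0 <= t < T ->
  (forall s, 0 <= s <= t -> 0 <= u x s <= M) ->
  (@lebesgue_measure R).-integrable `[0, t] (EFin \o (fun s => u x s `^ q)).
Proof.
move=> su cx tT uM; have t0 : 0 <= t by case/andP: tT.
apply: (@bounded_integrable R _ (measurableTypeR R) lebesgue_measure
  (`[0, t]%classic : set R) _ _ _ _ _ (powR_bounded (ltW q0) uM)).
- exact: measurable_itv.
- exact: segment_finite.
- by apply: (sol_time_measurable bO su).
Qed.

Lemma memory_ge0 u x t : 0 <= memory u x t.
Proof. by apply: Rintegral_ge0 => s _; exact: powR_ge0. Qed.

Lemma memory_le M u x t : sol u -> closure Omega x -> 0 <= t < T ->
  (forall s, 0 <= s <= t -> 0 <= u x s <= M) -> memory u x t <= M `^ q * t.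
Proof.
move=> su cx tT uM; have t0 : 0 <= t by case/andP: tT.
rewrite [X in _ <= _ * X](_ : t =
  fine (lebesgue_measure (`[0, t]%classic : set R))); last first.
  by rewrite lebesgue_measure_itv0.
rewrite -Rintegral_cst; last exact: measurable_itv.
apply: le_Rintegral.
- exact: measurable_itv.
- exact: memory_integrable su cx tT uM.
- apply: (@bounded_integrable R _ (measurableTypeR R) lebesgue_measure
    (`[0, t]%classic : set R) _ _ _ `|M `^ q|) => //.
  exact: segment_finite.
- move=> s st; apply: le_trans (ler_norm _) _; exact: (powR_bounded (ltW q0) uM).
Qed.

(** The integrand is nonnegative, so the part over [[0, s1]] bounds the whole from below. A lower
    bound for [u] on a short initial interval is thus remembered at all later times, even if [u]
    becomes small. *)
Lemma memory_ge c M s1 u x t : sol u -> closure Omega x -> 0 <= t < T ->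
  (forall s, 0 <= s <= t -> 0 <= u x s <= M) -> 0 <= s1 <= t -> 0 <= c ->
  (forall s, 0 <= s <= s1 -> c <= u x s) -> c `^ q * s1 <= memory u x t.
Proof.
move=> su cx tT uM /andP[s0 s1t] c00 uc; have t0 : 0 <= t by case/andP: tT.
have tT' : t < T by case/andP: tT.
have /andP[_ s1T] : 0 <= s1 < T by rewrite s0 (le_lt_trans s1t).
have intu := memory_integrable su cx tT uM.
have intu1 : (@lebesgue_measure R).-integrable `[0, s1] (EFin \o (fun s => u x s `^ q)).
  apply: (memory_integrable (M := M)) su cx _ _; first by rewrite s0.
  by move=> s /andP[s00 ss1]; apply: uM; rewrite s00 (le_trans ss1).
have := @Rintegral_itvB R (fun s => u x s `^ q) (BLeft 0) (BRight t) s1 intu.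
rewrite !bnd_simp => /(_ s0 s1t) E.
have ge0 : 0 <= \int[lebesgue_measure]_(s in `]s1, t]) (u x s `^ q).
  by apply: Rintegral_ge0 => s _; exact: powR_ge0.
apply: (@le_trans _ _ (memory u x s1)); last by rewrite -subr_ge0 E.
rewrite [X in _ * X <= _](_ : s1 =
  fine (lebesgue_measure (`[0, s1]%classic : set R))); last first.
  by rewrite lebesgue_measure_itv0.
rewrite -Rintegral_cst; last exact: measurable_itv.
apply: le_Rintegral => //.
- apply: (@bounded_integrable R _ (measurableTypeR R) lebesgue_measure
    (`[0, s1]%classic : set R) _ _ _ `|c `^ q|) => //.
  exact: segment_finite.
- move=> s; rewrite /= in_itv /= => ss; have cu := uc _ ss.
  by rewrite ge0_ler_powR ?(ltW q0) ?nnegrE// (le_trans c00).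
Qed.

Lemma is_derive_expR_scale (c : R) (s : R) :
  is_derive s 1 (fun s => expR (c * s)) (c * expR (c * s)).
Proof.
have := is_derive1_comp (is_derive_expR (c * s)) (is_deriveZ c (is_derive_id s 1)).
by rewrite /GRing.scale /= mulr1 mulrC; apply.
Qed.

Lemma is_derive_exp_factor (c r : R) (s : R) :
  is_derive s 1 (fun s => r * expR (c * s)) (r * (c * expR (c * s))).
Proof. exact: (is_deriveZ r (is_derive_expR_scale c s)). Qed.

(** A Lipschitz bound along two given solutions rather than on an interval of values: it can then
    come either from [r >= 1] or from the positivity of one of them. *)
Definition powR_close (L t1 r : R) u v := forall x t, closure Omega x ->
  0 <= t <= t1 -> `|u x t `^ r - v x t `^ r| <= L * `|u x t - v x t|.

Lemma powR_closeC L t1 r u v : powR_close L t1 r u v -> powR_close L t1 r v u.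
Proof. by move=> H x t cx tt; rewrite distrC [`|v x t - _|]distrC; exact: H. Qed.

(* [u - v] cannot touch [mu e^(lam t) phi] from below: at an interior point this
   contradicts the equation once [lam] is large, at a boundary point it
   contradicts the nonlocal flux condition once [phi] is steep. *)
Lemma no_touching (t1 L M K C lam mu : R) u v phi g h :
  sol u -> sol v -> 0 <= L -> 0 <= M -> 0 <= K -> 0 < mu -> t1 < T ->
  (forall x t, closure Omega x -> 0 <= t <= t1 -> 0 <= u x t <= M) ->
  (forall x t, closure Omega x -> 0 <= t <= t1 -> 0 <= v x t <= M) ->
  (forall x y t, boundary Omega x -> closure Omega y -> 0 <= t <= t1 ->
    `|k x y t| <= K) ->
  powR_close L t1 p u v -> powR_close L t1 q u v -> powR_close L t1 l u v ->
  (forall x, C2at phi g h x) -> (forall x, closure Omega x -> 1 <= phi x <= 2) ->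
  (forall x, boundary Omega x ->
    2 * K * L * vol + 1 <= \sum_(i < n) nu x 0 i * g i x) ->
  0 <= C -> (forall x, closure Omega x -> `|\sum_(i < n) h i x| <= C) ->
  C + a * (L * M `^ q * t1 + 2 * M `^ p * L * t1) < lam ->
  (forall x t, closure Omega x -> 0 <= t <= t1 ->
    `|u x t - v x t| <= mu * expR (lam * t) * phi x) ->
  forall x0 t0, closure Omega x0 -> 0 < t0 <= t1 ->
    u x0 t0 - v x0 t0 = mu * expR (lam * t0) * phi x0 -> False.
Proof.
move=> su sv L0 M0 K0 mu0 t1T uM vM kK Lp Lq Ll Cphi phi12 gN C0 hC lamC W
  x0 t0 cx0 /andP[t00 t0t1] weq.
pose E := mu * expR (lam * t0); have E0 : 0 < E by rewrite mulr_gt0 ?expR_gt0.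
have t0s : 0 <= t0 <= t1 by rewrite ltW.
have t0T : 0 <= t0 < T by rewrite ltW//= (le_lt_trans t0t1).
have t0T' : 0 < t0 < T by rewrite t00 (le_lt_trans t0t1).
have t1_ge0 : 0 <= t1 by rewrite (le_trans (ltW t00)).
have Wle y : closure Omega y ->
    u y t0 - v y t0 - E * phi y <= u x0 t0 - v x0 t0 - E * phi x0.
  move=> cy; rewrite weq subrr subr_le0.
  by apply: le_trans (ler_norm _) (W _ _ cy _).
have lam0 : 0 < lam.
  apply: le_lt_trans lamC; rewrite addr_ge0// mulr_ge0 ?(ltW a0)//.
  by rewrite addr_ge0// !mulr_ge0 ?powR_ge0.
(* The nonlocal terms involve the whole domain and all earlier times; [phi <= 2] and the
   monotonicity of the exponential bound them by the single number [E]. *)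
have We y t : closure Omega y -> 0 <= t <= t0 -> `|u y t - v y t| <= 2 * E.
  move=> cy /andP[tp tt0]; have tt : 0 <= t <= t1 by rewrite tp (le_trans tt0).
  apply: le_trans (W _ _ cy tt) _; have /andP[ph1 ph2] := phi12 _ cy.
  have me : 0 <= mu * expR (lam * t) by rewrite mulr_ge0 ?expR_ge0 ?ltW.
  apply: (@le_trans _ _ (2 * (mu * expR (lam * t)))); first by rewrite mulrC ler_wpM2r.
  by rewrite ler_pM2l// /E ler_pM2l// ler_expR ler_pM2l.
have [Ox|bx] := (closure_domainE oO x0).1 cx0; last first.
  have [Gu Cu fu] := sol_C1up bO su T0 t0T.
  have [Gv Cv fv] := sol_C1up bO sv T0 t0T.
  have := boundary_max_normal oO hnu (C1up_sub E Cu Cv Cphi) bx Wle.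
  rewrite -scaleN1r -[- (E *: _)]scaleN1r scalerA !dotvDr !dotvZr.
  rewrite (fu t00 _ bx) (fv t00 _ bx) => H.
  have gE : dotv (nu x0) (\row_i g i x0) = \sum_(i < n) nu x0 0 i * g i x0.
    by apply: eq_bigr => i _; rewrite mxE.
  have fd : `|nonlocal_flux Omega l k t0 (u^~ t0) x0
      - nonlocal_flux Omega l k t0 (v^~ t0) x0| <= K * (L * (2 * E)) * vol.
    apply: (flux_dist (K := K) (M := M) su sv bx t0T) => //.
    - by move=> y Oy; apply: kK => //; exact: subset_closure.
    - by move=> y Oy; apply: uM => //; exact: subset_closure.
    - by move=> y Oy; apply: vM => //; exact: subset_closure.
    - move=> y Oy; have cy := subset_closure Oy.
      apply: le_trans (Ll _ _ cy t0s) _; rewrite ler_wpM2l// We//.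
      by rewrite ltW//= lexx.
  have := gN _ bx; rewrite -gE => gN'.
  have := le_trans (ler_norm _) fd.
  move: H gN' E0.
  move: (dotv _ _) (nonlocal_flux _ _ _ _ _ _) (nonlocal_flux _ _ _ _ _ _) vol.
  move=> D f1 f2 V H1 H2 H3 H4.
  (* The flux difference is at most [2 * K * L * V * E]; the [+ 1] in the slope of [phi] leaves an
     excess [E > 0], which contradicts the boundary maximum. *)
  have : E * (2 * K * L * V + 1) <= E * D by rewrite ler_pM2l.
  have -> : E * (2 * K * L * V + 1) = K * (L * (2 * E)) * V + E by ring.
  lra.
have ph := phi12 _ cx0; have /andP[ph1 ph2] := ph.
have Hlap : laplacian (u^~ t0) x0 - laplacian (v^~ t0) x0 <= E * C.
  apply: (@le_trans _ _ (E * \sum_(i < n) h i x0)); last first.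
    by rewrite ler_pM2l// (le_trans (ler_norm _))// hC.
  apply: (laplacian_max (sol_twice_partial bO su Ox t0T')
    (sol_twice_partial bO sv Ox t0T') Cphi).
  have : nbhs x0 Omega by exact: open_nbhs_nbhs.
  by apply: filterS => y Oy; apply/Wle/subset_closure.
have du := sol_is_derive_time su Ox t0T'.
have dv := sol_is_derive_time sv Ox t0T'.
(* At fixed [x0], the difference minus the barrier has a left maximum at [t0], so the time
   derivative of [u - v] is at least that of the barrier, [E * phi x0 * lam]. *)
have dE := is_derive_exp_factor lam (mu * phi x0) t0.
have Ht := derive_ge0_left_max t00 (is_deriveB (is_deriveB du dv) dE).
have {}Ht : (forall s, t0 - t0 < s < t0 ->
    u x0 s - v x0 s - mu * phi x0 * expR (lam * s) <=
    u x0 t0 - v x0 t0 - mu * phi x0 * expR (lam * t0)) ->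
    0 <= _ := Ht.
pose Du := laplacian (u^~ t0) x0 + a * u x0 t0 `^ p * memory u x0 t0
  - b * u x0 t0 `^ m.
pose Dv := laplacian (v^~ t0) x0 + a * v x0 t0 `^ p * memory v x0 t0
  - b * v x0 t0 `^ m.
have {Ht} Ht : E * phi x0 * lam <= Du - Dv.
  rewrite -subr_ge0 [E * _ * _](_ : _ = mu * phi x0 * (lam * expR (lam * t0))).
    apply: Ht => s /andP[]; rewrite subrr => s0 st0.
    rewrite weq [X in _ <= X](_ : _ = 0); last by ring.
    rewrite subr_le0 mulrAC; apply: le_trans (ler_norm _) (W _ _ cx0 _).
    by rewrite ltW//= (le_trans (ltW st0)).
  by rewrite /E; ring.
have ux := uM _ _ cx0 t0s; have vx := vM _ _ cx0 t0s.
have /andP[ux0 uxM] := ux; have /andP[vx0 vxM] := vx.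
have ph0 : 0 < phi x0 by exact: lt_le_trans ltr01 ph1.
have uv0 : 0 < u x0 t0 - v x0 t0 by rewrite weq !mulr_gt0 ?expR_gt0.
have Hm : v x0 t0 `^ m <= u x0 t0 `^ m.
  by rewrite ge0_ler_powR ?(ltW m0) ?nnegrE// -subr_ge0 ltW.
have uM' s : 0 <= s <= t0 -> 0 <= u x0 s <= M.
  by move=> /andP[s0 st0]; apply: uM => //; rewrite s0 (le_trans st0).
have vM' s : 0 <= s <= t0 -> 0 <= v x0 s <= M.
  by move=> /andP[s0 st0]; apply: vM => //; rewrite s0 (le_trans st0).
have Iu := memory_le su cx0 t0T uM'.
have Id : `|memory u x0 t0 - memory v x0 t0| <= L * (2 * E) * t0.
  apply: (memory_dist su sv cx0 t0T uM' vM') => s ss.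
  apply: (@le_trans _ _ (L * `|u x0 s - v x0 s|)).
    by apply: Lq => //; case/andP: ss => -> /= st; exact: le_trans t0t1.
  by rewrite ler_wpM2l// We.
have Hp : u x0 t0 `^ p * memory u x0 t0 - v x0 t0 `^ p * memory v x0 t0 <=
    E * phi x0 * (L * M `^ q * t1 + 2 * M `^ p * L * t1).
  (* The two terms multiplied by [a] in [lamC] come from this splitting: the change of the p-th
     power against the bounded memory, and the bounded p-th power against the change of memory. *)
  rewrite (_ : _ - _ = (u x0 t0 `^ p - v x0 t0 `^ p) * memory u x0 t0 +
    v x0 t0 `^ p * (memory u x0 t0 - memory v x0 t0)); last first.
    by move: (memory u x0 t0) (memory v x0 t0) (_ `^ _) (_ `^ _) => *; ring.
  rewrite [leRHS]mulrDr; apply: lerD.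
    apply: (@le_trans _ _ (L * (E * phi x0) * (M `^ q * t1))); last first.
      by rewrite le_eqVlt; apply/orP; left; apply/eqP; ring.
    have up : `|u x0 t0 `^ p - v x0 t0 `^ p| <= L * (E * phi x0).
      by apply: le_trans (Lp _ _ cx0 t0s) _; rewrite (gtr0_norm uv0) weq.
    apply: (@le_trans _ _ (`|u x0 t0 `^ p - v x0 t0 `^ p| * memory u x0 t0)).
      by rewrite ler_wpM2r ?memory_ge0// ler_norm.
    apply: ler_pM; rewrite ?memory_ge0//.
    by apply: le_trans Iu _; rewrite ler_wpM2l ?powR_ge0.
  apply: (@le_trans _ _ (M `^ p * (L * (2 * E) * t1))).
    apply: (@le_trans _ _ (v x0 t0 `^ p * `|memory u x0 t0 - memory v x0 t0|)).
      by rewrite ler_wpM2l ?powR_ge0// ler_norm.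
    apply: ler_pM; rewrite ?powR_ge0//.
      by rewrite ge0_ler_powR ?nnegrE.
    by apply: le_trans Id _; rewrite ler_wpM2l// !mulr_ge0// ltW.
  (* The factor 1 is then enlarged to [phi x0], so that every term carries the same positive factor
     [E * phi x0], which cancels at the end. *)
  rewrite (_ : M `^ p * _ = E * 1 * (2 * M `^ p * L * t1)); last by ring.
  rewrite ler_wpM2r//; first by rewrite !mulr_ge0 ?powR_ge0.
  by rewrite ler_wpM2l// ltW.
have DuDv : Du - Dv = (laplacian (u^~ t0) x0 - laplacian (v^~ t0) x0) +
    a * (u x0 t0 `^ p * memory u x0 t0 - v x0 t0 `^ p * memory v x0 t0)
    - b * (u x0 t0 `^ m - v x0 t0 `^ m).
  by rewrite /Du /Dv; move: (memory u x0 t0) (memory v x0 t0) (laplacian _ _)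
    (laplacian _ _) (_ `^ _) (_ `^ _) => *; ring.
have H1 : Du - Dv <= E * C +
    a * (E * phi x0 * (L * M `^ q * t1 + 2 * M `^ p * L * t1)).
  rewrite DuDv; apply: (@le_trans _ _ ((laplacian (u^~ t0) x0 - laplacian (v^~ t0) x0) +
    a * (u x0 t0 `^ p * memory u x0 t0 - v x0 t0 `^ p * memory v x0 t0))).
    by rewrite gerBl mulr_ge0 ?(ltW b0)// subr_ge0.
  by rewrite lerD// ler_pM2l.
have H2 : E * C <= E * phi x0 * C.
  by rewrite -mulrA ler_pM2l// ler_peMl.
have H3 : 0 < E * phi x0 by rewrite mulr_gt0.
move: lamC; rewrite -(ltr_pM2l H3) ltNge => /negP; apply.
apply: le_trans Ht _; apply: le_trans H1 _.
by rewrite [leRHS]mulrDr lerD// mulrCA.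
Qed.

Lemma cylinder_nonempty t0 t1 : t0 <= t1 -> cylinder Omega t0 t1 !=set0.
Proof.
move=> tt; have [x Ox] : Omega !=set0 by case: bO.
by exists (x, t0); split=> /=; [exact: subset_closure|rewrite in_itv /= lexx].
Qed.

Lemma uniqueness_of_powR_close (t1 L : R) u v : sol u -> sol v ->
  0 <= t1 < T -> 0 <= L -> powR_close L t1 p u v ->
  powR_close L t1 q u v -> powR_close L t1 l u v ->
  forall x t, closure Omega x -> 0 <= t <= t1 -> u x t = v x t.
Proof.
move=> su sv /andP[t10 t1T] L0 Lp Lq Ll.
have [Mu Mu0 uM] := sol_bounded bO su T0 t1T.
have [Mv Mv0 vM] := sol_bounded bO sv T0 t1T.
have [K K0 kK] := kernel_bounded t1.
have [phi [g [h [Cphi phi12 gN [C C0 hC]]]]] :=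
  steep_barrier bO hnu sO (2 * K * L * vol + 1).
pose M := Num.max Mu Mv.
have M0 : 0 <= M by rewrite le_max Mu0.
have {}uM x t : closure Omega x -> 0 <= t <= t1 -> 0 <= u x t <= M.
  by move=> cx tt; have /andP[-> /= uM'] := uM x t cx tt; rewrite le_max uM'.
have {}vM x t : closure Omega x -> 0 <= t <= t1 -> 0 <= v x t <= M.
  by move=> cx tt; have /andP[-> /= vM'] := vM x t cx tt; rewrite le_max vM' orbT.
pose lam := C + a * (L * M `^ q * t1 + 2 * M `^ p * L * t1) + 1.
have lamC : C + a * (L * M `^ q * t1 + 2 * M `^ p * L * t1) < lam by rewrite ltrDl.
have phi0 x : closure Omega x -> 0 < phi x.
  by move=> cx; have /andP[p1 _] := phi12 x cx; exact: lt_le_trans ltr01 p1.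
(* The maximum [mu] of [W] is the least constant for which the barrier dominates the difference on
   the cylinder, so equality holds where it is attained. If [mu > 0], this happens at a positive
   time, because the initial values agree. *)
pose W z := `|u z.1 z.2 - v z.1 z.2| * expR (- (lam * z.2)) / phi z.1.
have cW : {within cylinder Omega 0 t1, continuous W}.
  rewrite continuous_subspace_in => z; rewrite inE => -[/= cz _].
  have cphi : {within cylinder Omega 0 t1, continuous (fun z => phi z.1)}.
    apply: continuous_subspaceT => y.
    apply: (@continuous_comp _ _ _ fst phi); first exact: cvg_fst.
    by case: (Cphi y.1).
  have cexp : {within cylinder Omega 0 t1, continuous (fun z => expR (- (lam * z.2)))}.
    apply: continuous_subspaceT => y.
    apply: (@continuous_comp _ _ _ snd (fun t : R => expR (- (lam * t)))).
      exact: cvg_snd.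
    apply: (@continuous_comp _ _ _ (fun t : R => - (lam * t)) expR).
      apply: continuousN; apply: continuousM; [exact: cst_continuous|exact: cvg_id].
    exact: continuous_expR.
  apply: cvgM; last by apply: cvgV; [rewrite gt_eqF// phi0|exact: cphi].
  apply: cvgM; last exact: cexp.
  apply: cvg_norm; apply: cvgB.
    exact: (sol_continuous bO su (lexx 0) t1T).
  exact: (sol_continuous bO sv (lexx 0) t1T).
have [[x0 t0]] := compact_EVT_max (cylinder_nonempty t10)
  (compact_cylinder bO (t0 := 0) (t1 := t1)) cW.
rewrite inE => -[/= cx0]; rewrite in_itv /= => /andP[t00 t0t1] Wmax.
set mu := W (x0, t0) in Wmax.
have WE x t : closure Omega x ->
    `|u x t - v x t| = W (x, t) * expR (lam * t) * phi x.
  move=> cx; rewrite /W /= mulrAC divfK ?gt_eqF ?phi0//.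
  by rewrite -mulrA -expRD addNr expR0 mulr1.
have Wle x t : closure Omega x -> 0 <= t <= t1 ->
    `|u x t - v x t| <= mu * expR (lam * t) * phi x.
  move=> cx tt; rewrite WE// !ler_pM2r ?expR_gt0 ?phi0//.
  by apply: Wmax; rewrite inE; split=> //=; rewrite in_itv.
suff mu0 : mu <= 0.
  move=> x t cx tt; apply/eqP; rewrite -subr_eq0 -normr_le0.
  apply: le_trans (Wle _ _ cx tt) _.
  by rewrite mulr_le0_ge0 ?(ltW (phi0 _ cx))// mulr_le0_ge0 ?expR_ge0.
rewrite leNgt; apply/negP => mu0.
have t0p : 0 < t0.
  rewrite lt_neqAle t00 andbT; apply/eqP => t0E; move: mu0.
  rewrite /mu /W /= -t0E (sol_initial bO su T0 c0 cx0) (sol_initial bO sv T0 c0 cx0).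
  by rewrite subrr normr0 !mul0r ltxx.
have t0s : 0 < t0 <= t1 by rewrite t0p.
(* [no_touching] is oriented: the sign of the difference at the contact decides which solution comes
   first. *)
have [uv|vu] := leP 0 (u x0 t0 - v x0 t0).
  apply: (@no_touching t1 L M K C lam mu u v phi g h su sv) (cx0) (t0s) _ => //.
  by rewrite -(ger0_norm uv) WE.
apply: (@no_touching t1 L M K C lam mu v u phi g h sv su) (cx0) (t0s) _ => //;
  try exact: powR_closeC.
  by move=> x t cx tt; rewrite distrC Wle.
by rewrite -opprB -(ltr0_norm vu) WE.
Qed.

(* If [eps e^(-lam (t - d)) (3 - phi)] crossed [u], the crossing would
   contradict the differential inequality or the sign of the flux. *)
Lemma positivity (d t1 c s0 beta : R) u : sol u -> 0 <= d -> t1 < T -> 0 < c ->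
  0 < s0 -> 0 <= beta -> (forall x, closure Omega x -> c <= u x d) ->
  (forall x t, Omega x -> d < t <= t1 -> u x t < s0 ->
    - (beta * u x t) <= a * u x t `^ p * memory u x t - b * u x t `^ m) ->
  forall x t, closure Omega x -> d <= t <= t1 -> 0 < u x t.
Proof.
move=> su d0 t1T c_gt0 s00 beta0 uc ineq x t cx /andP[dt tt1].
have dt1 : d <= t1 by exact: le_trans tt1.
(* Slope 1 is enough: the flux of [u] is nonnegative, whereas [3 - phi], which again lies between 1
   and 2, has normal derivative at most -1. *)
have [phi [g [h [Cphi phi12 gN [C C0 hC]]]]] := steep_barrier bO hnu sO 1.
(* The barrier is at most [2 * eps], half of the minimum of [c] and [s0]: it lies below [c] at time
   [d], and [u] is below [s0] wherever it is crossed. In [lam], [C] pays for the Laplacian, [beta]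
   for the reaction, and the [+ 1] makes the contradiction strict. *)
pose lam := C + beta + 1; pose eps := Num.min c s0 / 4.
have mc : Num.min c s0 <= c by rewrite ge_min lexx.
have ms : Num.min c s0 <= s0 by rewrite ge_min lexx orbT.
have m0' : 0 < Num.min c s0 by rewrite lt_min c_gt0.
have eps0 : 0 < eps by rewrite divr_gt0.
pose E t := eps * expR (- lam * (t - d)).
have E0 s : 0 < E s by rewrite mulr_gt0 ?expR_gt0.
have lam0 : 0 < lam by rewrite /lam; lra.
have Eeps s : d <= s -> E s <= eps.
  move=> ds; rewrite -[leRHS]mulr1 /E ler_pM2l// -expR0 ler_expR.
  by rewrite mulNr oppr_le0 mulr_ge0 ?subr_ge0// ltW.
pose Z z := u z.1 z.2 + E z.2 * phi z.1 - 3 * E z.2.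
have cE : {within cylinder Omega d t1, continuous (fun z => E z.2)}.
  apply: continuous_subspaceT => y.
  apply: (@continuous_comp _ _ _ snd E); first exact: cvg_snd.
  apply: continuousM; first exact: cst_continuous.
  apply: (@continuous_comp _ _ _ (fun t : R => - lam * (t - d)) expR).
    apply: continuousM; first exact: cst_continuous.
    by apply: continuousB; [exact: cvg_id|exact: cst_continuous].
  exact: continuous_expR.
have cphi : {within cylinder Omega d t1, continuous (fun z => phi z.1)}.
  apply: continuous_subspaceT => y.
  apply: (@continuous_comp _ _ _ fst phi); first exact: cvg_fst.
  by case: (Cphi y.1).
have cZ : {within cylinder Omega d t1, continuous Z}.
  move=> z; apply: cvgB; last by apply: cvgM; [exact: cvg_cst|exact: cE].
  apply: cvgD; first exact: (sol_continuous bO su d0 t1T).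
  by apply: cvgM; [exact: cE|exact: cphi].
have [[x0 t0]] := compact_EVT_min (cylinder_nonempty dt1)
  (compact_cylinder bO (t0 := d) (t1 := t1)) cZ.
rewrite inE => -[/= cx0]; rewrite in_itv /= => /andP[dt0 t0t1] Zmin.
have {}Zmin y s : closure Omega y -> d <= s <= t1 -> Z (x0, t0) <= Z (y, s).
  by move=> cy ss; apply: Zmin; rewrite inE; split=> //=; rewrite in_itv.
suff Z0 : 0 <= Z (x0, t0).
  have := le_trans Z0 (Zmin _ _ cx (introT andP (conj dt tt1))).
  rewrite /Z /= => H.
  have /andP[_ ph2] := phi12 _ cx.
  have : E t * phi x <= E t * 2 by rewrite ler_pM2l.
  by have := E0 t; lra.
rewrite leNgt; apply/negP => Z0.
have /andP[ph1 ph2] := phi12 _ cx0.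
have Eph : E t0 <= E t0 * phi x0 by rewrite ler_peMr// ltW.
have Eph2 : E t0 * phi x0 <= E t0 * 2 by rewrite ler_pM2l.
have E0' := E0 t0; have Ee := Eeps _ dt0.
have t0d : d < t0.
  rewrite lt_neqAle dt0 andbT; apply/eqP => dE.
  move: Z0; rewrite /Z /= -dE => Z0; have := uc _ cx0.
  by rewrite /eps dE in Ee *; rewrite dE in Z0; lra.
have ule : u x0 t0 < 3 * E t0 - E t0 * phi x0 by move: Z0; rewrite /Z /=; lra.
have us0 : u x0 t0 < s0 by rewrite /eps in Ee; lra.
have t00 : 0 < t0 by exact: le_lt_trans t0d.
have t0T : 0 <= t0 < T by rewrite ltW//= (le_lt_trans t0t1).
have t0T' : 0 < t0 < T by rewrite t00 (le_lt_trans t0t1).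
have uge0 : 0 <= u x0 t0 by apply: (sol_ge0 bO su).
have Zx y : closure Omega y ->
    0 - u y t0 - E t0 * phi y <= 0 - u x0 t0 - E t0 * phi x0.
  move=> cy; have := Zmin y t0 cy; rewrite dt0 t0t1 /Z /= => /(_ isT); lra.
have [Ox|bx] := (closure_domainE oO x0).1 cx0; last first.
  have [Gu Cu fu] := sol_C1up bO su T0 t0T.
  (* The zero function stands for the first of the two functions, so that the difference lemmas
     apply to [0 - u]. *)
  have C0up : C1up Omega (fun=> 0) (fun=> 0).
    split=> [||y i Oy]; [exact/continuous_subspaceT/cst_continuous
      |exact/continuous_subspaceT/cst_continuous|].
    by rewrite mxE; exact: is_derive_cst.
  have := boundary_max_normal oO hnu (C1up_sub (E t0) C0up Cu Cphi) bx Zx.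
  rewrite sub0r -scaleN1r -[- (E t0 *: _)]scaleN1r scalerA !dotvDr !dotvZr.
  rewrite (fu t00 _ bx) => H.
  have gE : dotv (nu x0) (\row_i g i x0) = \sum_(i < n) nu x0 0 i * g i x0.
    by apply: eq_bigr => i _; rewrite mxE.
  have fl := flux_ge0 u bx (ltW t00).
  have := gN _ bx; rewrite -gE => gN'.
  have : E t0 * 1 <= E t0 * dotv (nu x0) (\row_i g i x0) by rewrite ler_pM2l.
  lra.
have Hlap : 0 - laplacian (u^~ t0) x0 <= E t0 * C.
  apply: (@le_trans _ _ (E t0 * \sum_(i < n) h i x0)); last first.
    by rewrite ler_pM2l// (le_trans (ler_norm _))// hC.
  rewrite -[X in X - _](laplacian_cst 0 x0).
  apply: (laplacian_max (twice_partial_cst 0 x0)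
    (sol_twice_partial bO su Ox t0T') Cphi).
  have : nbhs x0 Omega by exact: open_nbhs_nbhs.
  by apply: filterS => y Oy; apply/Zx/subset_closure.
have du := sol_is_derive_time su Ox t0T'.
have EE s : E s = eps * expR (lam * d) * expR (- lam * s).
  by rewrite /E -mulrA -expRD; congr (_ * expR _); ring.
have dE : is_derive t0 1 (fun s : R => (phi x0 - 3) * E s)
    ((phi x0 - 3) * (E t0 * - lam)).
  have := is_derive_exp_factor (- lam) ((phi x0 - 3) * (eps * expR (lam * d))) t0.
  rewrite [X in is_derive _ _ X](_ : _ = fun s : R => (phi x0 - 3) * E s); last first.
    by apply/funext => s; rewrite EE !mulrA.
  rewrite [X in is_derive _ _ _ X](_ : _ = (phi x0 - 3) * (E t0 * - lam))//.
  by rewrite EE; ring.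
have t0d' : 0 < t0 - d by rewrite subr_gt0.
have Ht := derive_le0_left_min t0d' (is_deriveD du dE).
pose D := laplacian (u^~ t0) x0 + a * u x0 t0 `^ p * memory u x0 t0
  - b * u x0 t0 `^ m.
have {}Ht : D + (phi x0 - 3) * (E t0 * - lam) <= 0.
  apply: Ht => s; rewrite subKr => /andP[ds st0].
  have := Zmin x0 s cx0; rewrite (ltW ds) (le_trans (ltW st0))// /Z /= => /(_ isT) H.
  suff : u x0 t0 + (phi x0 - 3) * E t0 <= u x0 s + (phi x0 - 3) * E s by [].
  by rewrite !mulrBl ![phi x0 * _]mulrC; lra.
have t0d'' : d < t0 <= t1 by rewrite t0d.
have := ineq _ _ Ox t0d'' us0.
move: Ht; rewrite /D.
move: (memory u x0 t0) (laplacian _ _) Hlap (_ `^ p) (_ `^ m) => I Lp Hlap U1 U2 Ht Hi.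
(* The value of the barrier at the contact. It dominates both [u x0 t0] and [E t0], so the losses
   are at most [(C + beta) * s], less than the gain [lam * s]. *)
pose s := (3 - phi x0) * E t0.
have us : u x0 t0 <= s by rewrite /s mulrBl [phi x0 * _]mulrC ltW.
have Es : E t0 <= s by rewrite /s ler_peMl ?(ltW E0')//; lra.
have H1 : beta * u x0 t0 <= beta * s by rewrite ler_wpM2l.
have H2 : E t0 * C <= s * C by rewrite ler_wpM2r.
have H3 : (phi x0 - 3) * (E t0 * - lam) = s * C + beta * s + s.
  by rewrite /s /lam; ring.
by rewrite H3 in Ht; lra.
Qed.

(** * Uniqueness from bounds on powers *)

Lemma powR_close_le L L' t1 r u v : L <= L' ->
  powR_close L t1 r u v -> powR_close L' t1 r u v.
Proof.
by move=> LL H x t cx tt; apply: le_trans (H _ _ cx tt) _; rewrite ler_wpM2r.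
Qed.

Lemma powR_close_ge1 t1 r u v : sol u -> sol v -> t1 < T -> 1 <= r ->
  exists2 L, 0 <= L & powR_close L t1 r u v.
Proof.
move=> su sv t1T r1.
have [Mu Mu0 uM] := sol_bounded bO su T0 t1T.
have [Mv Mv0 vM] := sol_bounded bO sv T0 t1T.
have [L L0 HL] := powR_lipschitz_ge1 (Num.max Mu Mv) r1.
exists L => // x t cx tt; apply: HL.
  by have /andP[-> /= H] := uM _ _ cx tt; rewrite le_max H.
by have /andP[-> /= H] := vM _ _ cx tt; rewrite le_max H orbT.
Qed.

(** The minimum of [u] over the compact cylinder is attained, hence positive; it is the [c] of
    [powR_lipschitz_pos], whose asymmetry lets [v] vanish. *)
Lemma powR_close_pos t1 r u v : sol u -> sol v -> 0 <= t1 < T -> 0 <= r ->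
  (forall x t, closure Omega x -> 0 <= t <= t1 -> 0 < u x t) ->
  exists2 L, 0 <= L & powR_close L t1 r u v.
Proof.
move=> su sv /andP[t10 t1T] r0 up.
have [Mu Mu0 uM] := sol_bounded bO su T0 t1T.
have [Mv Mv0 vM] := sol_bounded bO sv T0 t1T.
have [[x1 t'] + umin] := compact_EVT_min (cylinder_nonempty t10)
  (compact_cylinder bO (t0 := 0) (t1 := t1)) (sol_continuous bO su (lexx 0) t1T).
rewrite inE => -[/= cx1]; rewrite in_itv /= => t't.
have [L L0 HL] := powR_lipschitz_pos (Num.max Mu Mv) r0 (up _ _ cx1 t't).
exists L => // x t cx tt; apply: HL.
  have /andP[_ /= H] := uM _ _ cx tt; rewrite le_max H andbT.
  have /= -> // := umin (x, t).
  by rewrite inE; split=> //=; rewrite in_itv.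
by have /andP[-> /= H] := vM _ _ cx tt; rewrite le_max H orbT.
Qed.

Lemma uniqueness_from_close u v : sol u -> sol v ->
  (forall t1 r, 0 <= t1 < T -> r \in [:: p; q; l] ->
    exists2 L, 0 <= L & powR_close L t1 r u v) ->
  forall x t, closure Omega x -> 0 <= t < T -> u x t = v x t.
Proof.
move=> su sv H x t cx tT; have t0 : 0 <= t by case/andP: tT.
have [Lp Lp0 Hp] := H t p tT (mem_head _ _).
have [Lq Lq0 Hq] : exists2 L, 0 <= L & powR_close L t q u v.
  by apply: H => //; rewrite !inE eqxx orbT.
have [Ll Ll0 Hl] : exists2 L, 0 <= L & powR_close L t l u v.
  by apply: H => //; rewrite !inE eqxx !orbT.
pose L := Lp + Lq + Ll.
have L0 : 0 <= L by rewrite !addr_ge0.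
apply: (uniqueness_of_powR_close su sv tT L0) => //.
- by apply: powR_close_le Hp; rewrite /L; lra.
- by apply: powR_close_le Hq; rewrite /L; lra.
- by apply: powR_close_le Hl; rewrite /L; lra.
- by rewrite t0 lexx.
Qed.

Lemma uniqueness_pos u v : sol u -> sol v ->
  (forall x t, closure Omega x -> 0 <= t < T -> 0 < u x t) ->
  forall x t, closure Omega x -> 0 <= t < T -> u x t = v x t.
Proof.
move=> su sv up; apply: uniqueness_from_close => // t1 r t1T rpql.
apply: powR_close_pos => //.
  by move: rpql; rewrite !inE => /or3P[] /eqP-> //; exact: ltW.
move=> x t cx /andP[t0 tt1]; apply: up => //; rewrite t0 /= (le_lt_trans tt1)//.
by case/andP: t1T.
Qed.

(** * Positivity for positive initial data *)

Section positive_datum.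
Context u (su : sol u) (u0p : forall x, closure Omega x -> 0 < u0 x).

Lemma positive_datum_bound : exists2 c, 0 < c &
  forall x, closure Omega x -> c <= u x 0.
Proof.
have cne : closure Omega !=set0.
  by case: bO => -[x Ox] *; exists x; exact: subset_closure.
have [y + ymin] := compact_EVT_min cne (compact_closure_domain bO) c0.
rewrite inE => cy; exists (u0 y); first exact: u0p.
move=> x cx; rewrite (sol_initial bO su T0 c0 cx).
by apply: ymin; rewrite inE.
Qed.

Lemma positive_m_ge1 : 1 <= m ->
  forall x t, closure Omega x -> 0 <= t < T -> 0 < u x t.
Proof.
move=> m1 x t cx /andP[t0 tT].
have [M M0 uM] := sol_bounded bO su T0 tT.
have [c cp uc] := positive_datum_bound.
(* As [m >= 1] and [u <= M], the absorption is at most [beta * u] for this [beta]. That holds for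
   all values of [u] up to [M], so the threshold [s0 = 1] is an arbitrary choice. *)
have beta0 : 0 <= b * M `^ (m - 1) by rewrite mulr_ge0 ?powR_ge0// ltW.
apply: (positivity su (d := 0) (t1 := t) (c := c) (s0 := 1)
  (beta := b * M `^ (m - 1))) => //; last by rewrite t0 lexx.
move=> y s Oy /andP[s0 st] _.
have /andP[uy0 uyM] : 0 <= u y s <= M.
  by apply: uM; [exact: subset_closure|rewrite ltW].
have H1 : 0 <= a * u y s `^ p * memory u y s.
  by rewrite !mulr_ge0 ?powR_ge0 ?memory_ge0 ?ltW.
have H2 : b * u y s `^ m <= b * M `^ (m - 1) * u y s.
  rewrite -mulrA ler_pM2l// -mulr_powRB1// mulrC ler_wpM2r//.
  by rewrite ge0_ler_powR ?subr_ge0 ?nnegrE.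
by rewrite -[leLHS]add0r lerD// lerN2.
Qed.

(** Continuity at time 0 made uniform in [x]: the points where [u <= c / 2] form a compact set,
    whose least time is positive because [u >= c] at time 0. *)
Lemma positive_initially t1 : 0 <= t1 < T ->
  exists2 d, 0 < d & exists2 c, 0 < c & forall x t, closure Omega x ->
    0 <= t <= t1 -> t <= d -> c <= u x t.
Proof.
move=> /andP[t10 t1T]; have [c cp uc] := positive_datum_bound.
pose A := cylinder Omega 0 t1; pose U z := u z.1 z.2.
have cU : {within A, continuous U} by exact: (sol_continuous bO su (lexx 0) t1T).
have cA : compact A := compact_cylinder bO (t0 := 0) (t1 := t1).
pose F := A `&` U @^-1` [set r | r <= c / 2].
have clA : closed A by apply: compact_closed => //; exact: norm_hausdorff.
have clF : closed F.
  rewrite /F closed_setSI//.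
  by apply: (@closed_comp (subspace A) _ U) => [z _|]; [exact: cU|exact: closed_le].
have cF : compact F by apply: subclosed_compact clF cA _ => z [].
have [[z Fz]|F0] := pselect (F !=set0); last first.
  exists 1 => //; exists (c / 2); first by rewrite divr_gt0.
  move=> x t cx tt _; rewrite leNgt; apply/negP => ut; apply: F0.
  exists (x, t); split; last exact: ltW.
  by split=> //=; rewrite in_itv.
have csnd : {within F, continuous (fun z : 'rV[R]_n * R => z.2)}.
  by apply: continuous_subspaceT => y; exact: cvg_snd.
have [[y s] + smin] := compact_EVT_min (ex_intro _ z Fz) cF csnd.
rewrite inE => -[[/= cy]]; rewrite in_itv /= => /andP[s0 st1] Us.
have sp : 0 < s.
  rewrite lt_neqAle s0 andbT; apply/eqP => sE.
  by move: Us; rewrite /U /= -sE; have := uc _ cy; lra.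
exists (s / 2); first by rewrite divr_gt0.
exists (c / 2); first by rewrite divr_gt0.
move=> x t cx tt ts; rewrite leNgt; apply/negP => ut.
have := smin (x, t); rewrite inE /= => H.
have : s <= t by apply: H; split=> /=; [split=> //=; rewrite in_itv|exact: ltW].
lra.
Qed.

(** After time [d] the memory is at least [c1], and since [p < m] the reaction dominates the
    absorption as long as [u] stays below [s0]. So [positivity] applies from time [d] with
    [beta = 0], and the interval before [d] is covered by [positive_initially]. *)
Lemma positive_m_lt1 : p < m ->
  forall x t, closure Omega x -> 0 <= t < T -> 0 < u x t.
Proof.
move=> pm x t cx tT; have [t0 tT'] := andP tT.
have [d dp [c cp uc]] := positive_initially tT.
have [td|dt] := leP t d.
  by apply: lt_le_trans cp _; apply: uc => //; rewrite t0 lexx.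
have [M M0 uM] := sol_bounded bO su T0 tT'.
pose c1 := c `^ q * d; have c1p : 0 < c1 by rewrite mulr_gt0 ?powR_gt0.
(* The value of [u] at which the absorption balances the reaction when the memory equals its lower
   bound [c1]. *)
pose s0 := (a * c1 / b) `^ (m - p)^-1.
have r0 : 0 < a * c1 / b by rewrite divr_gt0// mulr_gt0.
have mp : 0 < m - p by rewrite subr_gt0.
have s00 : 0 < s0 by rewrite powR_gt0.
apply: (positivity su (d := d) (t1 := t) (c := c) (s0 := s0)
  (beta := 0)) => //; [exact: ltW| | |by rewrite ltW/=].
  by move=> y cy; apply: uc => //; rewrite !ltW.
move=> y s Oy /andP[ds st] us; have cy := subset_closure Oy.
have sp : 0 < s by exact: lt_trans ds.
have sT : 0 <= s < T by rewrite ltW//= (le_lt_trans st).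
have uM' s' : 0 <= s' <= s -> 0 <= u y s' <= M.
  by move=> /andP[s'0 s's]; apply: uM => //; rewrite s'0 (le_trans s's).
have ds' : 0 <= d <= s by rewrite !ltW.
have Hmem : c1 <= memory u y s.
  apply: (memory_ge su cy sT uM' ds' (ltW cp)) => s' /andP[s'0 s'd].
  by apply: uc => //; rewrite s'0 (le_trans s'd)// ltW.
rewrite mul0r oppr0 subr_ge0.
have /andP[us0 _] : 0 <= u y s <= M by apply: uM' ; rewrite lexx ltW.
have [->|u_neq0] := eqVneq (u y s) 0.
  by rewrite powR0 ?gt_eqF// mulr0 !mulr_ge0 ?powR_ge0 ?memory_ge0 ?ltW.
have -> : u y s `^ m = u y s `^ p * u y s `^ (m - p).
  by rewrite -powRD ?u_neq0 ?implybT// subrKC.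
have H : u y s `^ (m - p) <= a * c1 / b.
  have -> : a * c1 / b = s0 `^ (m - p).
    by rewrite /s0 -powRrM mulVf ?gt_eqF// powRr1// ltW.
  by rewrite ge0_ler_powR ?(ltW mp) ?nnegrE ?(ltW s00) ?(ltW us).
apply: (@le_trans _ _ (u y s `^ p * (a * c1))).
  rewrite mulrCA ler_wpM2l ?powR_ge0// mulrC -ler_pdivlMr//.
by rewrite mulrCA mulrA ler_wpM2l// mulr_ge0 ?powR_ge0// ltW.
Qed.

End positive_datum.

End comparison.

Theorem theorem4 (R : realType) (n : nat) (hn : (1 <= n)%N)
    (Omega : set 'rV[R]_n) (hOmega : bounded_domain Omega)
    (hsmooth : smooth_boundary Omega)
    (nu : 'rV[R]_n -> 'rV[R]_n) (hnu : unit_outward_normal Omega nu)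
    (p q m l a b : R) (hp : 0 <= p) (hq : 0 < q) (hm : 0 < m) (hl : 0 < l)
    (ha : 0 < a) (hb : 0 < b)
    (k : 'rV[R]_n -> 'rV[R]_n -> R -> R)
    (hk : {within (boundary Omega `*` closure Omega) `*` `[0, +oo[,
             continuous (fun z => k z.1.1 z.1.2 z.2)})
    (hk0 : forall x y t, boundary Omega x -> closure Omega y -> 0 <= t ->
             0 <= k x y t)
    (u0 : 'rV[R]_n -> R) (hu0 : admissible_datum Omega nu l k u0)
    (T : R) (hT : 0 < T) :
  [\/ exists u, is_solution Omega nu p q m l a b k u0 T u /\
        (forall x t, (QT Omega T `|` GammaT Omega T) (x, t) -> 0 < u x t),
      [/\ exists u, is_solution Omega nu p q m l a b k u0 T u,
          forall x, Omega x -> 0 <= u0 x &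
          1 <= Num.min p (Num.min q l)] |
      [/\ exists u, is_solution Omega nu p q m l a b k u0 T u,
          forall x, closure Omega x -> 0 < u0 x &
          1 <= m \/ p < m < 1]] ->
  forall u v,
    is_solution Omega nu p q m l a b k u0 T u ->
    is_solution Omega nu p q m l a b k u0 T v ->
    forall x t, (QT Omega T `|` GammaT Omega T) (x, t) -> u x t = v x t.
Proof.
have [[c0 _ _] _ _] := hu0.
move=> H u v su sv x t /(QGammaE hOmega _ _ hT)[cx tT].
have upos w1 w2 : is_solution Omega nu p q m l a b k u0 T w1 ->
    is_solution Omega nu p q m l a b k u0 T w2 ->
    (forall x t, closure Omega x -> 0 <= t < T -> 0 < w1 x t) ->
    w1 x t = w2 x t.
  move=> s1 s2 w1p.
  exact: (uniqueness_pos hOmega hsmooth hnu hp hq hm hl ha hb hT hk c0 s1 s2 w1p).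
case: H => [[w [sw wp]]|[_ _]|[_ u0p]].
- have wp' y s : closure Omega y -> 0 <= s < T -> 0 < w y s.
    by move=> cy sT; apply/wp/QGammaE.
  (* Neither [u] nor [v] is known to be positive; each is compared with the given positive solution
     [w]. *)
  by rewrite -(upos w u)// -(upos w v).
- rewrite !le_min => /and3P[p1 q1 l1].
  apply: (uniqueness_from_close hOmega hsmooth hnu hp hq hm hl ha hb hT hk
    c0 su sv) => // t1 r /andP[_ t1T] rpql.
  apply: (powR_close_ge1 hOmega hT su sv t1T).
  by move: rpql; rewrite !inE => /or3P[] /eqP->.
(* Here every solution is positive, so [u] itself can be the positive one in the comparison. *)
- move=> mcase; apply: upos => //; case: mcase => [m1|/andP[pm _]].
    exact: (positive_m_ge1 hOmega hsmooth hnu hm ha hb hT hk0 c0 su u0p m1).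
  exact: (positive_m_lt1 hOmega hsmooth hnu hq hm ha hb hT hk0 c0 su u0p pm).
Qed.
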